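(* There exist problem-independent constants $C,C_1,C_2>0$ such that the following holds. Suppose that $\epsilon,\delta\in(0,1)$, $s\in\mathbb{N}^+$, $r\le d\le n$ and $m\le n$ are positive integers, and $E>0$ satisfy $$C\le E\le\frac{2e^{4r}}{[4r+\log(1/\delta)]\,\delta},\qquad m\ge E\,C_2^{-2}\epsilon^{-2}[4r+\log(1/\delta)].$$ Then for any matrix $A\in\mathbb{R}^{n\times d}$ with rank $r$ and $\mu(A)\le\bar\mu(\epsilon,\delta)\sqrt{s}$, where $$\bar\mu(\epsilon,\delta)=C_1\sqrt{C_2}\sqrt{\epsilon}\,\min\left\{\frac{\log(E/(C_2\epsilon))}{4r+\log(1/\delta)},\ \sqrt{\frac{\log E}{4r+\log(1/\delta)}}\right\},$$ a randomly generated $s$-hashing variant matrix $S\in\mathbb{R}^{m\times n}$ is an $\epsilon$-subspace embedding for $A$ with probability at least $1-\delta$.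
   Context: Coherence: if $A=U\Sigma V^T$ is the compact SVD of a rank-$r$ matrix $A$ ($U$ having $r$ orthonormal columns), then $\mu(A)=\max_i\|U_i\|_2$, where $U_i$ is the $i$-th row of $U$. $s$-hashing variant matrix: a random matrix $T\in\mathbb{R}^{m\times n}$ such that, independently for each column $j\in\{1,\dots,n\}$, indices $i_1,\dots,i_s\in\{1,\dots,m\}$ are sampled uniformly at random with replacement and, starting from zero, $\pm1/\sqrt{s}$ (independent signs, equal probability) is added to $T_{i_kj}$ for each $k=1,\dots,s$. $S$ is an $\epsilon$-subspace embedding for $A$ if $(1-\epsilon)\|Ax\|_2^2\le\|SAx\|_2^2\le(1+\epsilon)\|Ax\|_2^2$ for all $x\in\mathbb{R}^d$. *)

(* Defs.v *)
From HB Require Import structures.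
From mathcomp Require Import all_boot all_order all_algebra.
From mathcomp Require Import all_classical all_reals all_analysis.

Set Implicit Arguments.
Unset Strict Implicit.
Unset Printing Implicit Defensive.

Import Order.TTheory GRing.Theory Num.Theory.
Local Open Scope classical_set_scope.
Local Open Scope ring_scope.

(* The library norm on matrices is the sup norm, hence this definition. *)
Definition norm2 (R : realType) (n : nat) (v : 'cV[R]_n) : R :=
  Num.sqrt (\sum_(i < n) v i 0 ^+ 2).

(* The singular values are not required to be sorted: sorting them permutes
   the columns of U, which does not change the norms of its rows. *)
Definition compact_svd (R : realType) (n d r : nat) (A : 'M[R]_(n, d))
    (U : 'M[R]_(n, r)) (sigma : 'rV[R]_r) (V : 'M[R]_(d, r)) : Prop :=
  [/\ U^T *m U = 1%:M, V^T *m V = 1%:M, (forall k, 0 < sigma 0 k)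
    & A = U *m diag_mx sigma *m V^T].

Definition max_row_norm (R : realType) (n r : nat) (U : 'M[R]_(n, r)) : R :=
  \big[Num.max/0]_(i < n) norm2 (row i U)^T.

(* Every matrix has a compact SVD, and max_row_norm U is the same for all of
   them, so the set below is a singleton and the default value 0 of xget is
   never used. *)
Definition coherence (R : realType) (n d : nat) (A : 'M[R]_(n, d)) : R :=
  xget 0 [set mu | exists (U : 'M[R]_(n, \rank A)) (sigma : 'rV[R]_(\rank A))
                          (V : 'M[R]_(d, \rank A)),
                     compact_svd A U sigma V /\ mu = max_row_norm U].

Definition subspace_embedding (R : realType) (m n d : nat) (eps : R)
    (S : 'M[R]_(m, n)) (A : 'M[R]_(n, d)) : Prop :=
  forall x : 'cV[R]_d,
    (1 - eps) * norm2 (A *m x) ^+ 2 <= norm2 (S *m A *m x) ^+ 2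
      <= (1 + eps) * norm2 (A *m x) ^+ 2.

(* Mutual independence of a finite family of random variables with values in
   finite types carrying the discrete sigma-algebra, so that B i ranges over
   all subsets. *)
Definition mutually_independent (disp : measure_display)
    (Omega : measurableType disp) (R : realType) (P : probability Omega R)
    (I : finType) (V : I -> finType) (X : forall i, Omega -> V i) : Prop :=
  forall (J : {set I}) (B : forall i, set (V i)),
    P (\bigcap_(i in [set` J]) X i @^-1` B i) =
    (\prod_(i in J) P (X i @^-1` B i))%E.

Definition discrete_uniform (disp : measure_display)
    (Omega : measurableType disp) (R : realType) (P : probability Omega R)
    (V : finType) (X : Omega -> V) : Prop :=
  forall v : V, measurable (X @^-1` [set v]) /\
                P (X @^-1` [set v]) = (#|V|%:R^-1)%:E.

Definition draw_index (n s : nat) : finType :=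
  ('I_n * 'I_s + 'I_n * 'I_s)%type.

Definition draw_type (m n s : nat) (u : draw_index n s) : finType :=
  if u is inl _ then 'I_m else bool.

(* All the row indices (left summand) and all the signs (right summand),
   gathered into a single family. *)
Definition draw (Omega : Type) (m n s : nat)
    (h : 'I_n -> 'I_s -> Omega -> 'I_m) (b : 'I_n -> 'I_s -> Omega -> bool)
    (u : draw_index n s) : Omega -> draw_type m u :=
  match u with
  | inl jk => h jk.1 jk.2
  | inr jk => b jk.1 jk.2
  end.

(* h j k is the k-th row index sampled for column j, and (-1) ^+ b j k the
   sign that goes with it; indices sampled several times accumulate. *)
Definition hashing_variant (disp : measure_display)
    (Omega : measurableType disp) (R : realType) (P : probability Omega R)
    (m n s : nat) (S : Omega -> 'M[R]_(m, n)) : Prop :=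
  exists (h : 'I_n -> 'I_s -> Omega -> 'I_m)
         (b : 'I_n -> 'I_s -> Omega -> bool),
    [/\ forall j k, discrete_uniform P (h j k),
        forall j k, discrete_uniform P (b j k),
        mutually_independent P (draw h b)
      & forall w i j,
          S w i j = \sum_(k < s | h j k w == i)
                      (-1) ^+ b j k w / Num.sqrt s%:R].

Definition mubar (R : realType) (C1 C2 E eps delta : R) (r : nat) : R :=
  C1 * Num.sqrt C2 * Num.sqrt eps *
  Num.min (ln (E / (C2 * eps)) / (4 * r%:R + ln (1 / delta)))
          (Num.sqrt (ln E / (4 * r%:R + ln (1 / delta)))).

(* Main.v *)
(* The matrix S amounts to a random hashing with a single nonzero entry per
   column, applied to n * s coordinates.  So for a unit vector y and x = U y with entries
   scaled by 1 / sqrt s, the defect |S U y|^2 - |y|^2 is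
     Z = sum_i sum_(j <> k) [j and k both hashed to row i] (+-) x_j x_k.
   With p of order L = 4 r + log (1 / delta), expand E Z^p.  A term survives
   only if every coordinate occurs an even number of times and is used in a
   single row; then each coordinate of the support V contributes
   |x_j|^d / m <= nu^d * x_j^2 / (m nu^2), nu being a bound on |x_j|.  The sum
   is dominated by the one in which the rows are independent, row i
   contributing a moment F(q) over supports V with 2 <= |V| <= q.  Since all
   moments are nonnegative, the exponential generating function may be
   truncated at degree p:
     lam^p E Z^p <= p! (1 + sum_(2 <= q <= p) lam^q F(q) / q!)^m,
   and the two arguments of the minimum in mubar make the inner sum at most
   p / m when lam is a multiple of p / eps: the square root controls |V| = 2,
   the logarithm controls |V| >= 3.  This gives E Z^p <= (eps / 2)^p e^(-p),
   and Markov's inequality on a grid of at most e^(27 r) points of the unit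
   ball bounds the operator norm of (S U)^T (S U) - 1. *)

Require Import Defs.
From HB Require Import structures.
From mathcomp Require Import all_boot all_order all_algebra.
From mathcomp Require Import ring lra zify complex.
From mathcomp Require Import all_classical all_reals all_analysis.

Set Implicit Arguments.
Unset Strict Implicit.
Unset Printing Implicit Defensive.

Import Order.TTheory GRing.Theory Num.Theory.
Local Open Scope ring_scope.

(** * Compact singular value decomposition *)

Lemma trmx_mul_ge0 (R : realDomainType) (n : nat) (v : 'cV[R]_n) :
  0 <= (v^T *m v) 0 0.
Proof. by rewrite mxE sumr_ge0 // => i _; rewrite mxE -expr2 sqr_ge0. Qed.

Lemma trmx_mul_gt0 (R : realDomainType) (n : nat) (v : 'cV[R]_n) :
  v != 0 -> 0 < (v^T *m v) 0 0.
Proof.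
move=> v0; rewrite lt_neqAle trmx_mul_ge0 andbT eq_sym; apply: contra v0.
rewrite mxE psumr_eq0 => [/allP h|i _]; last by rewrite mxE -expr2 sqr_ge0.
apply/eqP/colP => i; have := h i (mem_index_enum _); rewrite !mxE mulf_eq0.
by rewrite orbb => /eqP.
Qed.

Lemma trmx_mul_self_eq0 (R : realDomainType) (n d : nat) (A : 'M[R]_(n, d)) :
  A^T *m A = 0 -> A = 0.
Proof.
move=> A0; apply/matrixP => i j.
have [/eqP c0|/trmx_mul_gt0] := boolP (col j A == 0).
  by have /colP/(_ i) := c0; rewrite !mxE.
suff -> : ((col j A)^T *m col j A) 0 0 = (A^T *m A) j j by rewrite A0 mxE ltxx.
by rewrite !mxE; apply: eq_bigr => k _; rewrite !mxE.
Qed.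

(** Over the complex numbers [B] becomes Hermitian, so the spectral theorem diagonalises it with a
    real diagonal, one entry of which is nonzero because [B] is. *)
Lemma symmetric_eigenvector (R : rcfType) (d : nat) (B : 'M[R]_d) :
  B^T = B -> B != 0 ->
  exists (a : R) (v : 'rV[R]_d), [/\ a != 0, v != 0 & v *m B = a *: v].
Proof.
move=> symB B0; pose C : numClosedFieldType := complex.complex R.
pose toC : {rmorphism R -> C} := complex.real_complex R.
pose BC := map_mx toC B.
have realBC : BC \is a mxOver Num.real.
  by apply/mxOverP => i j; rewrite mxE; apply/complex.complex_realP; exists (B i j).
have hermBC : BC \is hermsymmx.
  apply: realsym_hermsym => //.
  by apply/is_hermitianmxP; rewrite expr0 scale1r map_mx_id // /BC map_trmx symB.
have := hermitian_spectral_diag_real hermBC.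
set D := spectral_diag BC => realD.
have /orthomx_spectralP := hermitian_normalmx hermBC.
rewrite -/D; set Q := spectralmx BC => eqBC.
have unitQ : Q \in unitmx by exact: spectral_unit.
have [k Dk] : exists k, D 0 k != 0.
  apply/existsP; rewrite -[[exists _, _]]negbK; apply: contra B0 => /existsPn D0.
  have /eqP : BC = 0.
    rewrite eqBC (_ : D = 0) ?raddf0 ?mulmx0 ?mul0mx //.
    by apply/rowP => k; apply/eqP; have := D0 k; rewrite negbK mxE.
  by rewrite map_mx_eq0.
have [a Dka] : exists a, D 0 k = toC a.
  by apply/complex_realP; exact: (mxOverP realD).
have rowQ : row k Q *m BC = toC a *: row k Q.
  by rewrite eqBC -Dka !mulmxA -row_mul mulmxV // row1 -rowE row_diag_mx -scalemxAl -rowE.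
have rowQ0 : row k Q != 0.
  apply: contraTneq isT => rowQ0; have : row k (Q *m invmx Q) 0 k = 0.
    by rewrite row_mul rowQ0 mul0mx mxE.
  by rewrite mulmxV // !mxE eqxx => /eqP; rewrite oner_eq0.
have : eigenvalue BC (toC a) by apply/eigenvalueP; exists (row k Q).
(* The eigenvector [row k Q] is complex. Eigenvalues are the roots of the characteristic polynomial,
   which has real coefficients, so [a] also has a real eigenvector. *)
rewrite eigenvalue_root_char -map_char_poly fmorph_root -eigenvalue_root_char.
case/eigenvalueP => v vB v0; exists a, v; split => //.
by apply: contraNneq Dk => a0; rewrite Dka a0 (rmorph0 toC).
Qed.

(** A normalised eigenvector of [A^T *m A] serves as [v]; its eigenvalue [a] is positive, [s] is the
    square root of [a], and [u] is [A *m v] divided by [s]. *)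
Lemma singular_pair (R : rcfType) (n d : nat) (A : 'M[R]_(n, d)) :
  A != 0 ->
  exists (s : R) (u : 'cV[R]_n) (v : 'cV[R]_d),
    [/\ 0 < s, u^T *m u = 1%:M, v^T *m v = 1%:M, A *m v = s *: u
      & A^T *m u = s *: v].
Proof.
move=> A0; have [||a [w [a0 w0 wB]]] := @symmetric_eigenvector R d (A^T *m A).
- by rewrite trmx_mul trmxK.
- by apply: contra A0 => /eqP/trmx_mul_self_eq0/eqP.
have Bw : A^T *m A *m w^T = a *: w^T.
  by apply: trmx_inj; rewrite trmx_mul trmxK trmx_mul trmxK wB linearZ /= trmxK.
have norm_w : 0 < (w *m w^T) 0 0.
  by have := trmx_mul_gt0 (v := w^T); rewrite trmxK; apply; rewrite trmx_eq0.
have aE : (w *m (A^T *m A *m w^T)) 0 0 = a * (w *m w^T) 0 0.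
  by rewrite Bw -scalemxAr mxE.
have a_gt0 : 0 < a.
  rewrite lt_def a0 -(pmulr_lge0 _ norm_w) -aE.
  by have := trmx_mul_ge0 (A *m w^T); rewrite trmx_mul trmxK !mulmxA.
set c := (w *m w^T) 0 0 in norm_w aE.
pose v := (Num.sqrt c)^-1 *: w^T.
have vv : v^T *m v = 1%:M.
  rewrite /v [X in X *m _]linearZ /= trmxK -scalemxAl -scalemxAr scalerA.
  have -> : w *m w^T = c%:M by exact: mx11_scalar.
  rewrite -scalemx1 scalerA -invfM -expr2 sqr_sqrtr ?ltW //.
  by rewrite mulVf ?gt_eqF // scale1r.
have Bv : A^T *m A *m v = a *: v by rewrite -scalemxAr Bw scalerA mulrC -scalerA.
have sa_gt0 : 0 < Num.sqrt a by rewrite sqrtr_gt0.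
exists (Num.sqrt a), ((Num.sqrt a)^-1 *: (A *m v)), v; split => //.
- rewrite [X in X *m _]linearZ /= -scalemxAl -scalemxAr scalerA trmx_mul -mulmxA.
  rewrite [A^T *m _]mulmxA Bv -scalemxAr vv scalerA -invfM -expr2.
  by rewrite sqr_sqrtr ?ltW // mulVf ?scale1r.
- by rewrite scalerA mulfV ?gt_eqF // scale1r.
- by rewrite -scalemxAr mulmxA Bv scalerA -{2}[a]sqr_sqrtr ?ltW // expr2 mulKf ?gt_eqF.
Qed.

(* Deflation: subtracting a singular triple lowers the rank by one. *)
Lemma compact_svd_exists (R : realType) (n d r : nat) (A : 'M[R]_(n, d)) :
  \rank A = r ->
  exists (U : 'M[R]_(n, r)) (sigma : 'rV[R]_r) (V : 'M[R]_(d, r)),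
    compact_svd A U sigma V.
Proof.
elim: r A => [|r IH] A rA.
  exists 0, 0, 0; split; try by apply/matrixP => -[].
    by case.
  by move/eqP: rA; rewrite mxrank_eq0 => /eqP ->; rewrite !mul0mx.
have [|s [u [v [s0 uu vv Av Au]]]] := @singular_pair R n d A.
  by rewrite -mxrank_eq0 rA.
pose A' := A - s *: (u *m v^T).
have A'v : A' *m v = 0.
  by rewrite mulmxBl Av -scalemxAl -mulmxA vv mulmx1 subrr.
have A'u : A'^T *m u = 0.
  rewrite linearB linearZ /= trmx_mul trmxK mulmxBl Au -scalemxAl -mulmxA uu.
  by rewrite mulmx1 subrr.
have vA : v^T = (s^-1 *: u^T) *m A.
  apply: trmx_inj; rewrite trmxK trmx_mul linearZ /= trmxK -scalemxAr Au.
  by rewrite scalerA mulVf ?gt_eqF // scale1r.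
have rA' : \rank A' = r.
  have v_rank : \rank v^T = 1%N.
    apply/eqP; rewrite eqn_leq rank_leq_row lt0n mxrank_eq0 trmx_eq0.
    apply/eqP => v0; move/matrixP/(_ 0 0): vv; rewrite v0 mulmx0 !mxE eqxx.
    by move/eqP; rewrite eq_sym oner_eq0.
  (* The rows of [A'] are orthogonal to [v], which has norm 1, so the two row spaces meet trivially
     and the ranks add up. *)
  have cap0 : (A' :&: v^T)%MS = 0.
    apply/eqP; rewrite -submx0; apply/rV_subP => w.
    rewrite sub_capmx => /andP[/submxP[y wy] /submxP[z wz]].
    have : w *m v = 0 by rewrite wy -mulmxA A'v mulmx0.
    by rewrite wz -mulmxA vv mulmx1 => ->; rewrite mul0mx sub0mx.
  have eqA : (A :=: A' + v^T)%MS.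
    apply/eqmxP/andP; split.
      have {1}-> : A = A' + s *: (u *m v^T) by rewrite subrK.
      by rewrite addmx_sub_adds // scalemx_sub // submxMl.
    rewrite addsmx_sub; apply/andP; split; last by rewrite vA submxMl.
    by rewrite addmx_sub // eqmx_opp scalemx_sub // (submx_trans (submxMl _ _)) // vA submxMl.
  apply/eqP; rewrite -eqSS -rA eqA (mxrank_disjoint_sum cap0) v_rank.
  by rewrite addn1.
have [U [sigma [V [UU VV sig0 A'E]]]] := IH A' rA'.
pose D := diag_mx sigma.
have unitD : D \in unitmx.
  by rewrite unitmxE det_diag unitfE; apply/prodf_neq0 => k _; rewrite gt_eqF.
(* [A'] kills [v], and the factors [U] and [D] of [A'] can be cancelled from the left. *)
have Vv : V^T *m v = 0.
  have /(congr1 (mulmx (invmx D *m U^T))) := A'v.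
  by rewrite A'E mulmx0 !mulmxA -[invmx D *m _ *m U]mulmxA UU mulmx1 mulVmx // mul1mx.
have Uu : U^T *m u = 0.
  have /(congr1 (mulmx (invmx D *m V^T))) := A'u.
  rewrite A'E mulmx0 !trmx_mul trmxK tr_diag_mx !mulmxA.
  by rewrite -[invmx D *m _ *m V]mulmxA VV mulmx1 mulVmx // mul1mx.
exists (row_mx u U), (row_mx s%:M sigma), (row_mx v V).
(* row_mx u U has width 1 + r, which is only convertible to r.+1 *)
suff : @compact_svd R n d (1 + r) A (row_mx u U) (row_mx s%:M sigma) (row_mx v V).
  by [].
split.
- rewrite (tr_row_mx u U) mul_col_row uu UU Uu -[u^T *m U]trmxK trmx_mul trmxK Uu.
  by rewrite trmx0 -scalar_mx_block.
- rewrite (tr_row_mx v V) mul_col_row vv VV Vv -[v^T *m V]trmxK trmx_mul trmxK Vv.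
  by rewrite trmx0 -scalar_mx_block.
- move=> k; rewrite mxE; case: split_ordP => i _ //.
  by rewrite ord1 mxE eqxx.
rewrite (diag_mx_row s%:M sigma) (tr_row_mx v V) (mul_row_block u U) !mulmx0 addr0 add0r.
rewrite (mul_row_col (u *m _)) -A'E.
rewrite (_ : diag_mx s%:M = s%:M); last first.
  by apply/matrixP => i j; rewrite !ord1 !mxE eqxx.
by rewrite mul_mx_scalar -scalemxAl addrC subrK.
Qed.

(** The set in [coherence] is nonempty, so [xget] returns one of its elements and the coherence is
    realised by an actual compact SVD. *)
Lemma coherence_svd (R : realType) (n d : nat) (A : 'M[R]_(n, d)) :
  exists (U : 'M[R]_(n, \rank A)) (sigma : 'rV[R]_(\rank A))
         (V : 'M[R]_(d, \rank A)),
    compact_svd A U sigma V /\ coherence A = max_row_norm U.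
Proof.
have [U [sigma [V svd]]] := @compact_svd_exists R n d _ A erefl.
have [x x0|/(_ (max_row_norm U))] := @xgetP _ 0
  [set mu | exists (U : 'M[R]_(n, \rank A)) (sigma : 'rV[R]_(\rank A))
                   (V : 'M[R]_(d, \rank A)),
              compact_svd A U sigma V /\ mu = max_row_norm U]%classic.
  by rewrite /coherence x0.
by case; exists U, sigma, V.
Qed.

(** * Moments of the hashing defect *)

Lemma expr_sum_ffun (R : comPzRingType) (I : finType) (p : nat) (G : I -> R) :
  (\sum_i G i) ^+ p = \sum_(s : {ffun 'I_p -> I}) \prod_t G (s t).
Proof. by rewrite -(bigA_distr_bigA (fun=> G)) prodr_const card_ord. Qed.

Definition hash_entry (R : pzRingType) (J : finType) (m : nat) (x : J -> R)
    (f : {ffun J -> 'I_m * bool}) (i : 'I_m) (j : J) : R :=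
  ((f j).1 == i)%:R * ((-1) ^+ (f j).2 * x j).

(** This is |H x|^2 - |x|^2, where H is the matrix with one signed entry per column that [f]
    encodes. *)
Definition distortion (R : pzRingType) (J : finType) (m : nat) (x : J -> R)
    (f : {ffun J -> 'I_m * bool}) : R :=
  \sum_i (\sum_j hash_entry x f i j) ^+ 2 - \sum_j x j ^+ 2.

(** Each coordinate lies in exactly one row and its sign squares to 1, so the diagonal terms add up
    to |x|^2 and cancel. *)
Lemma distortion_offdiag (R : comPzRingType) (J : finType) (m : nat)
    (x : J -> R) (f : {ffun J -> 'I_m * bool}) :
  distortion x f = \sum_i \sum_(e : J * J)
    (e.1 != e.2)%:R * (hash_entry x f i e.1 * hash_entry x f i e.2).
Proof.
have diag : \sum_i \sum_j hash_entry x f i j ^+ 2 = \sum_j x j ^+ 2.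
  rewrite exchange_big; apply: eq_bigr => j _.
  rewrite (bigD1 (f j).1) //= big1 => [|i /negPf ne]; last first.
    by rewrite /hash_entry eq_sym ne mul0r expr0n.
  by rewrite /hash_entry eqxx mul1r exprMn sqrr_sign mul1r addr0.
rewrite /distortion -diag -sumrB; apply: eq_bigr => i _.
rewrite expr2 big_distrl /=.
under eq_bigr do rewrite big_distrr /=.
under [RHS]eq_bigr do rewrite mulr_natl mulrb.
rewrite pair_big -big_mkcond (bigID (fun e : J * J => e.1 != e.2)) /=.
rewrite -addrA [X in _ + X](_ : _ = 0) ?addr0 //; apply/eqP; rewrite subr_eq0.
under eq_bigl do rewrite negbK; apply/eqP.
rewrite -(pair_big_dep xpredT (fun a b : J => a == b)
  (fun a b => hash_entry x f i a * hash_entry x f i b)) /=.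
apply: eq_bigr => j _; rewrite expr2.
by under eq_bigl do rewrite eq_sym; rewrite big_pred1_eq.
Qed.

(* A monomial in the hash entries is given by a finite set of slots, the slot u
   standing for the entry in row rho u and column l u.  Its mean vanishes
   unless every column is consistent. *)
Definition slot_degree (U J : finType) (l : U -> J) (j : J) :=
  #|[pred u | l u == j]|.

Definition consistent_at (U J : finType) (m : nat) (rho : U -> 'I_m)
    (l : U -> J) (j : J) : bool :=
  ~~ odd (slot_degree l j) &&
  [forall u, forall v, (l u == j) && (l v == j) ==> (rho u == rho v)].

(** An odd degree makes the two signs cancel. For an even positive degree d, one row at most
    survives among [m], which costs 1/m, and |x|^d is at most nu^(d-2) x^2. *)
Lemma sum_hash_column_le (R : realFieldType) (U J : finType) (m : nat)
    (rho : U -> 'I_m) (l : U -> J) (j : J) (x nu : R) :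
  (0 < m)%N -> 0 < nu -> `|x| <= nu ->
  `|\sum_(o : 'I_m * bool)
      \prod_(u | l u == j) ((o.1 == rho u)%:R * ((-1) ^+ o.2 * x))|
  <= (2 * m)%:R * (nu ^+ slot_degree l j * ((consistent_at rho l j)%:R *
       (if (0 < slot_degree l j)%N then x ^+ 2 / (m%:R * nu ^+ 2) else 1))).
Proof.
move=> m0 nu0 xnu.
set d := slot_degree l j.
rewrite (eq_bigr (fun o : 'I_m * bool =>
  \prod_(u | l u == j) (o.1 == rho u)%:R * ((-1) ^+ o.2 * x) ^+ d)); last first.
  by move=> o _; rewrite big_split -prodr_const.
rewrite -(pair_bigA _ (fun (i : 'I_m) (b : bool) =>
  \prod_(u | l u == j) (i == rho u)%:R * ((-1) ^+ b * x) ^+ d)) /=.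
under eq_bigr do rewrite -big_distrr big_bool /=.
rewrite -big_distrl /= !exprMn expr0 expr1 expr1n mul1r.
have [d_odd|d_even] := boolP (odd d).
  by rewrite /consistent_at -/d -signr_odd d_odd expr1 mulN1r addNr mulr0 normr0 mul0r !mulr0.
rewrite -signr_odd (negPf d_even) expr0 mul1r.
have [d0|d_gt0] := posnP d.
  have no u : l u == j = false.
    by have /card0_eq/(_ u) := d0; rewrite !inE.
  rewrite [consistent_at _ _ _](_ : _ = true); last first.
    by rewrite /consistent_at -/d d0; apply/forallP => u; apply/forallP => v; rewrite no.
  rewrite d0 !expr0 !mul1r (eq_bigr (fun=> 1)) => [|i _]; last first.
    by rewrite big_pred0.
  by rewrite sumr_const card_ord -[1 + 1]/(2%:R) -natrM mulnC normr_nat !mulr1.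
have [coh|incoh] := boolP (consistent_at rho l j); last first.
  rewrite big1 ?mul0r ?normr0 ?mulr0 // => i _.
  move: incoh; rewrite /consistent_at d_even /=.
  case/forallPn => u /forallPn[v]; rewrite negb_imply => /andP[/andP[lu lv] ne].
  have [iu|iu] := eqVneq i (rho u); last by rewrite (bigD1 u) //= (negPf iu) mul0r.
  by rewrite (bigD1 v) //= iu (negPf ne) mul0r.
rewrite mul1r; have /card_gt0P[u0] := d_gt0; rewrite inE => lu0.
have -> : \sum_i \prod_(u | l u == j) (i == rho u)%:R = 1 :> R.
  rewrite (bigD1 (rho u0)) //= [X in _ + X]big1 ?addr0 => [|i /negPf ne].
    apply: big1 => u lu; case/andP: coh => _ /forallP/(_ u0)/forallP/(_ u).
    by rewrite lu0 lu => /eqP ->; rewrite eqxx.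
  by rewrite (bigD1 u0) //= ne mul0r.
have d_ge2 : (2 <= d)%N by move: d_gt0 d_even; case: (d) => [|[|]].
rewrite mul1r -mulr2n normrMn normrX natrM -[_ *+ 2]mulr_natl -mulrA ler_pM2l ?ltr0n //.
rewrite -(subnK d_ge2) !exprD real_normK ?num_real //.
have m_neq0 : m%:R != 0 :> R by rewrite pnatr_eq0 -lt0n.
rewrite (_ : m%:R * _ = nu ^+ (d - 2) * x ^+ 2); last first.
  by field; rewrite m_neq0 gt_eqF.
by rewrite ler_wpM2r ?sqr_ge0 // lerXn2r ?nnegrE ?(ltW nu0).
Qed.

(** The columns are hashed independently, so the sum over [f] factors into one sum per column. *)
Lemma mixed_moment_le (R : realFieldType) (U J : finType) (m : nat)
    (rho : U -> 'I_m) (l : U -> J) (x : J -> R) (nu : R) :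
  (0 < m)%N -> 0 < nu -> (forall j, `|x j| <= nu) ->
  \sum_(f : {ffun J -> 'I_m * bool}) \prod_u hash_entry x f (rho u) (l u) <=
  (2 * m)%:R ^+ #|J| * (nu ^+ #|U| * ([forall j, consistent_at rho l j]%:R *
    \prod_(j | (0 < slot_degree l j)%N) (x j ^+ 2 / (m%:R * nu ^+ 2)))).
Proof.
move=> m0 nu0 xnu.
pose a j := x j ^+ 2 / (m%:R * nu ^+ 2).
set PA := \prod_(j | (0 < slot_degree l j)%N) _.
pose g j (o : 'I_m * bool) := \prod_(u | l u == j) ((o.1 == rho u)%:R * ((-1) ^+ o.2 * x j)).
have -> : \sum_(f : {ffun J -> 'I_m * bool}) \prod_u hash_entry x f (rho u) (l u)
    = \prod_j \sum_o g j o.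
  rewrite bigA_distr_bigA; apply: eq_bigr => f _.
  rewrite (partition_big l xpredT) //=; apply: eq_bigr => j _.
  by apply: eq_bigr => u /eqP <-.
apply: (le_trans (ler_norm _)); rewrite normr_prod.
apply: (@le_trans _ _ (\prod_j ((2 * m)%:R * (nu ^+ slot_degree l j *
    ((consistent_at rho l j)%:R * (if (0 < slot_degree l j)%N
      then a j else 1)))))).
  apply: ler_prod => j _.
  by rewrite normr_ge0; apply: (sum_hash_column_le rho l j m0 nu0 (xnu j)).
rewrite !big_split /= prodr_const -big_mkcond /=.
rewrite prodrXr (_ : \sum_j slot_degree l j = #|U|)%N; last first.
  rewrite -sum1_card (partition_big l xpredT) //=.
  by apply: eq_bigr => j _; rewrite sum1_card.
suff -> : \prod_j (consistent_at rho l j)%:R =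
    [forall j, consistent_at rho l j]%:R :> R by exact: lexx.
have [/forallP coh|/forallPn[j /negPf incoh]] :=
    boolP [forall j, consistent_at rho l j].
  by rewrite big1 // => j _; rewrite coh.
by rewrite (bigD1 j) //= incoh mul0r.
Qed.

Definition row_support (U J : finType) (m : nat) (rho : U -> 'I_m)
    (l : U -> J) (i : 'I_m) : {set J} :=
  [set l u | u in [pred u | rho u == i]].

(** A column of the support has even positive degree and all its slots lie in row [i], so it uses at
    least two slots of that row. *)
Lemma card_row_support_le (U J : finType) (m : nat) (rho : U -> 'I_m)
    (l : U -> J) (i : 'I_m) :
  (forall j, consistent_at rho l j) ->
  (2 * #|row_support rho l i| <= #|[pred u | rho u == i]|)%N.
Proof.
move=> coh; rewrite -[X in (_ <= X)%N]sum1_card.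
rewrite (partition_big l (mem (row_support rho l i))) /=; last first.
  by move=> u rhou; apply: imset_f.
rewrite mulnC -sum_nat_const; apply: leq_sum => j /imsetP[v rhov ->].
case/andP: (coh (l v)) => even_d /forallP/(_ v)/forallP same.
have d_gt0 : (0 < slot_degree l (l v))%N by apply/card_gt0P; exists v; rewrite inE.
have : (2 <= slot_degree l (l v))%N.
  by move: d_gt0 even_d; case: (slot_degree _ _) => [|[]].
rewrite /slot_degree -sum1_card => /leq_trans; apply.
rewrite (eq_bigl (fun u => (u \in [pred u | rho u == i]) && (l u == l v))) // => u.
rewrite !inE; have [lu|] := boolP (l u == l v); rewrite ?andbF ?andbT //.
by have := same u; rewrite eqxx lu /= => /eqP <-; move: rhov; rewrite inE => ->.
Qed.

(** Consistency puts all slots of a column in a single row, so the row supports partition the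
    columns that occur. *)
Lemma prod_row_support (R : comPzRingType) (U J : finType) (m : nat)
    (rho : U -> 'I_m) (l : U -> J) (a : J -> R) :
  (forall j, consistent_at rho l j) ->
  \prod_(j | (0 < slot_degree l j)%N) a j =
  \prod_i \prod_(j in row_support rho l i) a j.
Proof.
move=> coh; rewrite (exchange_big_dep xpredT) //= big_mkcond; apply: eq_bigr => j _.
case: ifP => [/card_gt0P[u]|/negbT].
  rewrite inE => lu; rewrite (big_pred1 (rho u)) // => i.
  apply/imsetP/eqP => [[v]|->]; last by exists u; rewrite ?inE // (eqP lu).
  rewrite inE => /eqP <- jlv; case/andP: (coh j) => _ /forallP/(_ u)/forallP/(_ v).
  by rewrite lu -jlv eqxx => /eqP.
rewrite -eqn0Ngt => /eqP/card0_eq d0; rewrite big_pred0 // => i.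
by apply/imsetP => -[u _ jlu]; have := d0 u; rewrite !inE jlu eqxx.
Qed.

(* The possible cardinals of the set of columns occurring in a row that is
   chosen for q of the off-diagonal pairs: the two columns of a pair differ,
   and even degrees leave at most q distinct columns among the 2 q slots. *)
Definition admissible (q v : nat) := ((q == 0) && (v == 0) || (2 <= v <= q))%N.

(** The power of [#|V|] counts the labellings by [V] of the [2 * q] slots in a row chosen [q]
    times. *)
Definition support_moment (R : comPzRingType) (J : finType) (a : J -> R) (q : nat) : R :=
  \sum_(V : {set J} | admissible q #|V|) (\prod_(j in V) a j) * #|V|%:R ^+ (2 * q).

Lemma prod_by_fiber (R : comPzRingType) (I T : finType) (s : T -> I) (c : I -> R) :
  \prod_t c (s t) = \prod_i c i ^+ #|[pred t | s t == i]|.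
Proof.
rewrite (partition_big s xpredT) //=; apply: eq_bigr => i _.
by rewrite -prodr_const; apply: eq_big => t; rewrite ?inE // => /eqP ->.
Qed.

Definition slot_label (J : finType) (p : nat) (e : {ffun 'I_p -> J * J})
    (u : 'I_p * bool) : J :=
  if u.2 then (e u.1).1 else (e u.1).2.

(** Decouple the rows: sum over arbitrary families of admissible sets, one per row, asking only that
    the labels used in a row lie in its set. The true row supports of a consistent [e] form one such
    family, and all terms are nonnegative. *)
Lemma sum_consistent_le (R : realFieldType) (J : finType) (m p : nat) (s : {ffun 'I_p -> 'I_m})
    (a : J -> R) :
  (forall j, 0 <= a j) ->
  \sum_(e : {ffun 'I_p -> J * J}) \prod_t ((e t).1 != (e t).2)%:R *
    ([forall j, consistent_at (fun u => s u.1) (slot_label e) j]%:R *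
     \prod_(j | (0 < slot_degree (slot_label e) j)%N) a j)
  <= \prod_i support_moment a #|[pred t | s t == i]|.
Proof.
move=> a0; pose q i := #|[pred t | s t == i]|.
pose c i (V : {set J}) := (admissible (q i) #|V|)%:R * \prod_(j in V) a j.
have c0 i V : 0 <= c i V by rewrite mulr_ge0 ?ler0n // prodr_ge0.
pose inc (V : {ffun 'I_m -> {set J}}) (t : 'I_p) (e : J * J) : R :=
  ((e.1 \in V (s t)) && (e.2 \in V (s t)))%:R.
apply: (@le_trans _ _ (\sum_(e : {ffun 'I_p -> J * J})
   \sum_(V : {ffun 'I_m -> {set J}}) (\prod_i c i (V i)) * \prod_t inc V t (e t))).
  apply: ler_sum => e _.
  have pos (V : {ffun 'I_m -> {set J}}) : 0 <= (\prod_i c i (V i)) * \prod_t inc V t (e t).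
    by rewrite mulr_ge0 // prodr_ge0 // => *; rewrite ?ler0n.
  have [/forallP ne|/forallPn[t]] := boolP [forall t, (e t).1 != (e t).2]; last first.
    by rewrite negbK => /eqP et; rewrite (bigD1 t) //= et eqxx !mul0r sumr_ge0.
  pose rho (u : 'I_p * bool) := s u.1.
  have [/forallP coh|_] := boolP [forall j, consistent_at rho (slot_label e) j]; last first.
    by rewrite mul0r mulr0 sumr_ge0.
  pose V0 : {ffun 'I_m -> {set J}} := [ffun i => row_support rho (slot_label e) i].
  rewrite (bigD1 V0) //= ler_wpDr ?sumr_ge0 //.
  rewrite big1 ?mul1r => [|t _]; last by rewrite ne.
  rewrite [X in _ * X]big1 ?mulr1 => [|t _]; last first.
    rewrite /inc !ffunE.
    rewrite (imset_f (slot_label e) (x := (t, true))) ?inE ?eqxx //.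
    by rewrite (imset_f (slot_label e) (x := (t, false))) ?inE ?eqxx.
  rewrite (prod_row_support _ coh) le_eqVlt; apply/orP; left; apply/eqP.
  apply: eq_bigr => i _; rewrite /c ffunE.
  suff -> : admissible (q i) #|row_support rho (slot_label e) i| by rewrite mul1r.
  have le_q : (#|row_support rho (slot_label e) i| <= q i)%N.
    rewrite -(leq_pmul2l (isT : (0 < 2)%N)).
    apply: leq_trans (card_row_support_le _ coh) _.
    rewrite (eq_card (B := finset.setX [set t | s t == i]%SET [set: bool]%SET)) => [|[t b]].
      by rewrite cardsX cardsT card_bool mulnC cardsE.
    by rewrite !inE andbT.
  rewrite /admissible le_q andbT; have [qi0|qi0] := eqVneq (q i) 0%N.
    by apply/orP; left; rewrite -leqn0 -qi0.
  move: qi0; rewrite -lt0n => /card_gt0P[t]; rewrite inE => st; apply/orP; right.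
  apply: leq_trans (subset_leq_card (_ : [set (e t).1; (e t).2] \subset _)).
    by rewrite cards2 ne.
  apply/fintype.subsetP => j /set2P[] ->.
    by apply/imsetP; exists (t, true); rewrite ?inE.
  by apply/imsetP; exists (t, false); rewrite ?inE.
(* Once the family of sets is fixed, the two labels of each pair range freely over the set of its
   row. *)
rewrite exchange_big /= /support_moment.
rewrite (eq_bigr (fun i => \sum_(V : {set J}) c i V * #|V|%:R ^+ (2 * q i))); last first.
  by move=> i _; rewrite big_mkcond; apply: eq_bigr => V _; rewrite /c;
    case: admissible; rewrite ?mul1r ?mul0r.
rewrite bigA_distr_bigA le_eqVlt; apply/orP; left; apply/eqP.
apply: eq_bigr => V _; rewrite [RHS]big_split -big_distrr /=; congr (_ * _).
rewrite -(bigA_distr_bigA (inc V)).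
rewrite (eq_bigr (fun t => #|V (s t)|%:R ^+ 2)) => [|t _].
  by rewrite (prod_by_fiber s (fun i => #|V i|%:R ^+ 2)); apply: eq_bigr => i _; rewrite -exprM.
rewrite /inc; under eq_bigr do rewrite -mulnb natrM.
rewrite -(pair_bigA _ (fun a b : J => (a \in V (s t))%:R * (b \in V (s t))%:R)) /=.
under eq_bigr do rewrite -big_distrr.
by rewrite -big_distrl /= -!natr_sum -!sum1_card [in RHS]big_mkcond -expr2.
Qed.

Lemma distortion_moment_le (R : realFieldType) (J : finType) (m p : nat)
    (x : J -> R) (nu : R) :
  (0 < m)%N -> 0 < nu -> (forall j, `|x j| <= nu) ->
  \sum_(f : {ffun J -> 'I_m * bool}) distortion x f ^+ p <=
  (2 * m)%:R ^+ #|J| * (nu ^+ (2 * p) * \sum_(s : {ffun 'I_p -> 'I_m})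
    \prod_i support_moment (fun j => x j ^+ 2 / (m%:R * nu ^+ 2)) #|[pred t | s t == i]|).
Proof.
move=> m0 nu0 xnu.
pose ent (f : {ffun J -> 'I_m * bool}) (s : {ffun 'I_p -> 'I_m}) e (u : 'I_p * bool) :=
  hash_entry x f (s u.1) (slot_label e u).
have expand (f : {ffun J -> 'I_m * bool}) : distortion x f ^+ p =
    \sum_(s : {ffun 'I_p -> 'I_m}) \sum_(e : {ffun 'I_p -> J * J})
      (\prod_t ((e t).1 != (e t).2)%:R) * \prod_u ent f s e u.
  rewrite distortion_offdiag expr_sum_ffun; apply: eq_bigr => s _.
  rewrite bigA_distr_bigA; apply: eq_bigr => e _; rewrite big_split; congr (_ * _).
  rewrite -(pair_bigA _ (fun t b => ent f s e (t, b))) /=.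
  by apply: eq_bigr => t _; rewrite big_bool.
under eq_bigr do rewrite expand.
rewrite exchange_big /= big_distrr big_distrr /=; apply: ler_sum => s _.
rewrite exchange_big /=.
set a := fun j => x j ^+ 2 / (m%:R * nu ^+ 2).
have a0 j : 0 <= a j.
  apply: divr_ge0; first exact: sqr_ge0.
  by apply: mulr_ge0; [exact: ler0n | exact: sqr_ge0].
have K0 : 0 <= (2 * m)%:R ^+ #|J| * nu ^+ (2 * p).
  by rewrite mulr_ge0 ?exprn_ge0 ?ler0n ?(ltW nu0).
rewrite mulrA; apply: le_trans (ler_wpM2l K0 (sum_consistent_le s a0)).
rewrite big_distrr /=; apply: ler_sum => e _; rewrite -big_distrr /= [leRHS]mulrCA.
apply: ler_wpM2l; first by rewrite prodr_ge0 // => t _; rewrite ler0n.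
apply: le_trans (mixed_moment_le _ (slot_label e) m0 nu0 xnu) _.
rewrite card_prod card_ord card_bool [(p * 2)%N]mulnC -mulrA; exact: lexx.
Qed.

(** * Truncated exponential generating functions *)

Definition trunc_exp (R : fieldType) (p : nat) (z : R) : {poly R} :=
  \poly_(q < p.+1) (z ^+ q / q`!%:R).

Lemma coef_mul_trunc_exp (R : realFieldType) (p q : nat) (y z : R) (P : {poly R}) :
  (forall k, (k <= p)%N -> P`_k = z ^+ k / k`!%:R) -> (q <= p)%N ->
  (trunc_exp p y * P)`_q = (y + z) ^+ q / q`!%:R.
Proof.
move=> Pz qp; rewrite coefM addrC exprDn mulr_suml; apply: eq_bigr => i _.
have iq : (i <= q)%N by rewrite -ltnS.
rewrite coef_poly ltnS (leq_trans iq qp) Pz ?(leq_trans (leq_subr _ _) qp) //.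
have fact_neq0 k : k`!%:R != 0 :> R by rewrite pnatr_eq0 -lt0n fact_gt0.
rewrite -(bin_fact iq) !natrM -mulr_natl.
have b0 : 'C(q, i)%:R != 0 :> R by rewrite pnatr_eq0 -lt0n bin_gt0.
by field; rewrite b0 !fact_neq0.
Qed.

Lemma coef_prod_trunc_exp (R : realFieldType) (I : Type) (r : seq I) (p q : nat) (z : I -> R) :
  (q <= p)%N ->
  (\prod_(i <- r) trunc_exp p (z i))`_q = (\sum_(i <- r) z i) ^+ q / q`!%:R.
Proof.
elim: r q => [|i r IH] q qp.
  rewrite !big_nil coef1; case: q {qp} => [|q]; first by rewrite fact0 divr1.
  by rewrite expr0n mul0r.
by rewrite !big_cons; apply: coef_mul_trunc_exp.
Qed.

(* Any finite sequence is the sequence of moments of a signed measure on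
   {0, ..., p}; this reduces the exponential formula sum_prod_fiber to the
   identity exp (x + y) = exp x * exp y for truncated series. *)
Lemma moment_interpolation (R : realFieldType) (p : nat) (F : nat -> R) :
  exists w : 'I_p.+1 -> R, forall q, (q <= p)%N ->
    \sum_k w k * k%:R ^+ q = F q.
Proof.
pose V := Vandermonde p.+1 (\row_(k < p.+1) k%:R : 'rV[R]_p.+1).
have unitV : V \in unitmx.
  rewrite unitmxE unitfE det_Vandermonde; apply/prodf_neq0 => i _.
  apply/prodf_neq0 => j ij; rewrite !mxE subr_eq0 eqr_nat.
  by rewrite gtn_eqF.
pose c := invmx V *m \col_(q < p.+1) F q.
exists (fun k => c k 0) => q qp.
have : (V *m c) (Ordinal (qp : q < p.+1)%N) 0 = F q by rewrite mulKVmx // mxE.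
by rewrite mxE => <-; apply: eq_bigr => k _; rewrite !mxE mulrC.
Qed.

(** Writing [F] as moments of weights [w] turns both sides into a sum over [g] of the product of the
    [w (g i)] times the [p]-th power of the sum of the [g i]. *)
Lemma sum_prod_fiber (R : realFieldType) (m p : nat) (F : nat -> R) :
  \sum_(s : {ffun 'I_p -> 'I_m}) \prod_i F #|[pred t | s t == i]| =
  p`!%:R * ((\poly_(q < p.+1) (F q / q`!%:R)) ^+ m)`_p.
Proof.
have [w wF] := moment_interpolation p F.
have fib_le (s : {ffun 'I_p -> 'I_m}) i : (#|[pred t | s t == i]| <= p)%N.
  by rewrite -[X in (_ <= X)%N]card_ord max_card.
under eq_bigr => s _ do under eq_bigr => i _ do rewrite -wF //.
under eq_bigr => s _.
  rewrite bigA_distr_bigA.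
  under eq_bigr => g _ do rewrite big_split -(prod_by_fiber s (fun i => (g i)%:R)) /=.
  over.
rewrite exchange_big /=.
under eq_bigr => g _ do rewrite -big_distrr -(expr_sum_ffun p (fun i => (g i)%:R)) /=.
have -> : \poly_(q < p.+1) (F q / q`!%:R) = \sum_(k < p.+1) w k *: trunc_exp p k%:R.
  apply/polyP => q; rewrite coef_sum coef_poly.
  under eq_bigr do rewrite coefZ coef_poly.
  case: ltnP => [qp|_]; last by rewrite big1 // => k _; rewrite mulr0.
  by rewrite -wF // mulr_suml; apply: eq_bigr => k _; rewrite mulrA.
rewrite -[m in _ ^+ m](card_ord m) -prodr_const bigA_distr_bigA coef_sum mulr_sumr.
apply: eq_bigr => g _; rewrite scaler_prod coefZ coef_prod_trunc_exp //.
by rewrite mulrCA; congr (_ * _); rewrite mulrC divfK // pnatr_eq0 -lt0n fact_gt0.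
Qed.

Lemma coef_le_horner (R : realFieldType) (P : {poly R}) (p : nat) (c : R) :
  (forall i, 0 <= P`_i) -> 0 <= c -> c ^+ p * P`_p <= P.[c].
Proof.
move=> Ppos c0; rewrite horner_coef.
have pos i : 0 <= P`_i * c ^+ i by rewrite mulr_ge0 ?exprn_ge0.
case: (ltnP p (size P)) => [pP|Pp].
  by rewrite (bigD1 (Ordinal pP)) //= mulrC lerDl sumr_ge0.
by rewrite nth_default // mulr0 sumr_ge0.
Qed.

Lemma sum_prod_fiber_le (R : realFieldType) (m p : nat) (F : nat -> R) (c : R) :
  (forall q, 0 <= F q) -> 0 <= c ->
  c ^+ p * \sum_(s : {ffun 'I_p -> 'I_m}) \prod_i F #|[pred t | s t == i]| <=
  p`!%:R * (\sum_(q < p.+1) c ^+ q * F q / q`!%:R) ^+ m.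
Proof.
move=> F0 c0; rewrite sum_prod_fiber mulrCA ler_wpM2l ?ler0n //.
apply: le_trans (coef_le_horner _ _ c0) _.
  elim: m => [|m IH] q; first by rewrite expr0 coef1 ler0n.
  rewrite exprS coefM sumr_ge0 // => i _; rewrite mulr_ge0 // coef_poly.
  by case: ifP => // _; rewrite divr_ge0 ?ler0n.
rewrite horner_exp horner_poly lerXn2r ?nnegrE ?sumr_ge0 //.
- by move=> q _; rewrite mulr_ge0 ?exprn_ge0 ?divr_ge0 ?ler0n.
- by move=> q _; rewrite divr_ge0 ?mulr_ge0 ?exprn_ge0 ?ler0n.
by apply: ler_sum => q _; rewrite mulrC mulrA.
Qed.

(** * Numerical bounds on the generating function *)

Lemma exp_partial_sum_le (R : realType) (N : nat) (y : R) :
  0 <= y -> \sum_(0 <= k < N) y ^+ k / k`!%:R <= expR y.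
Proof.
move=> y0.
have := @nondecreasing_cvgn_le R (series (exp_coeff y)) _ (is_cvg_series_exp_coeff y) N.
apply.
apply/nondecreasing_seqP => n; rewrite /series /= big_nat_recr //= lerDl.
by rewrite /exp_coeff /= divr_ge0 ?exprn_ge0 ?ler0n.
Qed.

Lemma fact_le_expn (k : nat) : (k`! <= k ^ k)%N.
Proof.
elim: k => // k IH; rewrite factS expnS leq_mul2l /=.
by apply: (leq_trans IH); case: k {IH} => // k; rewrite leq_exp2r.
Qed.

(** The left side is a single term of the exponential series at [q]. *)
Lemma inv_fact_le (R : realType) (q : nat) :
  q%:R ^+ q / q`!%:R <= expR 1 ^+ q :> R.
Proof.
rewrite -expRM_natl mulr1.
apply: le_trans (exp_partial_sum_le q.+1 (ler0n R q)).
by rewrite big_nat_recr //= lerDr big_nat sumr_ge0.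
Qed.

(* Compare the coefficient of t^v in prod_j (1 + t a_j) <= e^(t A) at t = v / A. *)
Lemma elementary_symmetric_le (R : realType) (J : finType) (a : J -> R) (A : R) (v : nat) :
  (forall j, 0 <= a j) -> 0 < A -> \sum_j a j <= A -> (0 < v)%N ->
  \sum_(V : {set J} | #|V| == v) \prod_(j in V) a j <= (expR 1 * A / v%:R) ^+ v.
Proof.
move=> a0 A0 aA v0; pose t := v%:R / A.
have t0 : 0 < t by rewrite divr_gt0 ?ltr0n.
have -> : expR 1 * A / v%:R = expR 1 / t.
  by rewrite /t; field; rewrite gt_eqF // pnatr_eq0 -lt0n v0.
rewrite exprMn exprVn ler_pdivlMr ?exprn_gt0 // -expRM_natl mulr1.
have tA : t * \sum_j a j <= v%:R.
  by rewrite /t mulrAC ler_pdivrMr // ler_wpM2l.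
apply: (@le_trans _ _ (expR (t * \sum_j a j))); last by rewrite ler_expR.
rewrite mulr_sumr expR_sum.
apply: (@le_trans _ _ (\prod_j (t * a j + 1))); last first.
  apply: ler_prod => j _; rewrite addrC expR_ge1Dx andbT.
  by rewrite addr_ge0 // mulr_ge0 // ltW.
rewrite bigA_distr mulr_suml.
rewrite big_mkcond; apply: ler_sum => V _; rewrite -big_mkcond big_split /= prodr_const.
case: eqP => [->|_]; first by rewrite mulrC.
by rewrite mulr_ge0 ?exprn_ge0 ?(ltW t0) ?prodr_ge0.
Qed.

Lemma support_moment0 (R : comPzRingType) (J : finType) (a : J -> R) :
  support_moment a 0 = 1.
Proof.
rewrite /support_moment (big_pred1 finset.set0) => [|V]; last first.
  rewrite /admissible eqxx /= -cards_eq0; by case: #|V| => [|[|]].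
by rewrite muln0 expr0 mulr1 big_set0.
Qed.

Lemma support_moment_ge0 (R : realFieldType) (J : finType) (a : J -> R) (q : nat) :
  (forall j, 0 <= a j) -> 0 <= support_moment a q.
Proof.
by move=> a0; apply: sumr_ge0 => V _; rewrite mulr_ge0 ?exprn_ge0 ?prodr_ge0.
Qed.

Lemma support_moment_le (R : realType) (J : finType) (a : J -> R) (A : R) (q : nat) :
  (0 < q)%N -> (forall j, 0 <= a j) -> 0 < A -> \sum_j a j <= A ->
  support_moment a q <=
  \sum_(2 <= v < q.+1) (expR 1 * A / v%:R) ^+ v * v%:R ^+ (2 * q).
Proof.
move=> q0 a0 A0 aA.
have -> : support_moment a q = \sum_(2 <= v < q.+1)
    (\sum_(V : {set J} | #|V| == v) \prod_(j in V) a j) * v%:R ^+ (2 * q).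
  under [RHS]eq_bigr do rewrite mulr_suml.
  rewrite (exchange_big_dep xpredT) //= /support_moment big_mkcond.
  apply: eq_bigr => V _; rewrite (eq_bigl (pred1 #|V|)) => [|v]; last exact: eq_sym.
  by rewrite big_nat1_eq /admissible gtn_eqF // ltnS.
rewrite big_nat [leRHS]big_nat; apply: ler_sum => v /andP[v2 _].
by rewrite ler_wpM2r ?exprn_ge0 ?ler0n // elementary_symmetric_le // ltnW.
Qed.

(** Bounding 1/q! by (e/q)^q makes the left side at most the right side times (v/q)^v, which is at
    most 1. *)
Lemma moment_term_le (R : realType) (b A : R) (v q : nat) :
  0 <= b -> 0 <= A -> (0 < v)%N -> (v <= q)%N ->
  b ^+ q * ((expR 1 * A / v%:R) ^+ v * v%:R ^+ (2 * q)) / q`!%:R <=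
  (expR 1 ^+ 2 * b * A) ^+ v * (expR 1 * b * v%:R ^+ 2 / q%:R) ^+ (q - v).
Proof.
move=> b0 A0 v0 vq.
have q0 : (0 < q)%N by apply: leq_trans vq.
have qR : q%:R != 0 :> R by rewrite pnatr_eq0 -lt0n.
have vR : v%:R != 0 :> R by rewrite pnatr_eq0 -lt0n.
have invf : q`!%:R^-1 <= expR 1 ^+ q / q%:R ^+ q :> R.
  by rewrite ler_pdivlMr ?exprn_gt0 ?ltr0n // mulrC inv_fact_le.
have e0 : 0 <= expR 1 :> R by rewrite expR_ge0.
apply: le_trans (ler_wpM2l _ invf) _.
  by rewrite !(mulr_ge0, exprn_ge0, divr_ge0, ler0n).
have vq1 : (v%:R / q%:R) ^+ v <= 1 :> R.
  by rewrite exprn_ile1 ?divr_ge0 ?ler0n // ler_pdivrMr ?ltr0n // mul1r ler_nat.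
rewrite [leLHS](_ : _ = (expR 1 ^+ 2 * b * A) ^+ v *
  (expR 1 * b * v%:R ^+ 2 / q%:R) ^+ (q - v) * (v%:R / q%:R) ^+ v).
  by rewrite ler_piMr // !(mulr_ge0, exprn_ge0, divr_ge0, ler0n).
have expand (x : R) : x ^+ q = x ^+ (q - v) * x ^+ v by rewrite -exprD subnK.
rewrite mulnC exprM !exprMn !exprVn !expand.
have := expf_neq0 (q - v) qR; have := expf_neq0 v qR; have := expf_neq0 v vR.
move: (v%:R ^+ v) (q%:R ^+ v) (q%:R ^+ (q - v)) => x y z x0 y0 z0.
by field; rewrite x0 y0 z0.
Qed.

Lemma weighted_moment_sum_le (R : realType) (J : finType) (a : J -> R) (b A : R) (p : nat) :
  (forall j, 0 <= a j) -> 0 <= b -> 0 < A -> \sum_j a j <= A ->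
  \sum_(q < p.+1) b ^+ q * support_moment a q / q`!%:R <=
  1 + \sum_(2 <= v < p.+1) (expR 1 ^+ 2 * b * A) ^+ v *
      \sum_(0 <= k < p.+1 - v) (expR 1 * b * v%:R ^+ 2 / (k + v)%:R) ^+ k.
Proof.
move=> a0 b0 A0 aA; set g := expR 1 ^+ 2 * b * A.
rewrite big_ord_recl /= support_moment0 expr0 mulr1 fact0 divr1 lerD2l.
rewrite -(big_mkord xpredT (fun q => b ^+ q.+1 * support_moment a q.+1 / q.+1`!%:R)).
rewrite -(big_add1 _ _ 0 p.+1 xpredT (fun q => b ^+ q * support_moment a q / q`!%:R)).
apply: (@le_trans _ _ (\sum_(1 <= q < p.+1) \sum_(2 <= v < p.+1 | (v < q.+1)%N)
    g ^+ v * (expR 1 * b * v%:R ^+ 2 / q%:R) ^+ (q - v))).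
  rewrite [leLHS]big_nat [leRHS]big_nat; apply: ler_sum => q /andP[q1 qp].
  rewrite -(big_nat_widen 2 q.+1 p.+1 xpredT) // mulrAC.
  apply: le_trans (ler_wpM2l _ (support_moment_le q1 a0 A0 aA)) _.
    by rewrite divr_ge0 ?exprn_ge0 ?ler0n.
  rewrite mulr_sumr [leLHS]big_nat [leRHS]big_nat; apply: ler_sum => v /andP[v2 vq].
  rewrite mulrAC; apply: moment_term_le => //; first exact: ltW.
  exact: ltnW.
(* Sum over the support size [v] first; the index [k] is then [q - v]. *)
rewrite (exchange_big_dep_nat xpredT) //= le_eqVlt; apply/orP; left; apply/eqP.
rewrite big_nat [RHS]big_nat; apply: eq_bigr => v /andP[v2 vp].
under eq_bigl do rewrite ltnS.
rewrite -(big_nat_widenl v 1 p.+1 xpredT) ?(ltnW v2) // mulr_sumr.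
rewrite -{1}[v]add0n big_addn.
by apply: eq_bigr => k _; rewrite addnK.
Qed.

Lemma two_slot_sum_le (R : realType) (y : R) (N : nat) : 0 <= y ->
  \sum_(0 <= k < N) (y / (k + 2)%:R) ^+ k <= expR y.
Proof.
move=> y0; apply: le_trans (exp_partial_sum_le N y0); apply: ler_sum => k _.
rewrite exprMn exprVn ler_wpM2l ?exprn_ge0 //.
rewrite lef_pV2 ?posrE ?exprn_gt0 ?ltr0n ?addn2 ?fact_gt0 //.
rewrite -natrX ler_nat; apply: leq_trans (fact_le_expn k) _.
by case: k => // k; rewrite leq_exp2r // -addn2 leq_addr.
Qed.

Lemma sum_sqr_le_sqr_sum (R : realDomainType) (I : Type) (r : seq I) (t : I -> R) :
  (forall i, 0 <= t i) -> \sum_(i <- r) t i ^+ 2 <= (\sum_(i <- r) t i) ^+ 2.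
Proof.
move=> t0; elim: r => [|i r IH]; first by rewrite !big_nil expr0n.
rewrite !big_cons sqrrD -addrA lerD2l (le_trans IH) // lerDr mulrn_wge0 //.
by rewrite mulr_ge0 ?sumr_ge0.
Qed.

(** With y = l v / 6 and k + v at most [p], each term is at most the square of a term of the series
    of e^y. The sum of these squares is at most e^(2y). *)
Lemma many_slot_sum_le (R : realType) (b l : R) (v p : nat) :
  (3 <= v)%N -> (v <= p)%N -> 0 <= b -> 0 <= l -> expR 1 * b * p%:R <= (l / 6) ^+ 2 ->
  \sum_(0 <= k < p.+1 - v) (expR 1 * b * v%:R ^+ 2 / (k + v)%:R) ^+ k
  <= expR (l / 2) ^+ v.-1.
Proof.
move=> v3 vp b0 l0 bp.
have p0 : (0 < p)%N by apply: leq_trans vp; apply: leq_trans v3.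
pose y := l / 6 * v%:R.
have y0 : 0 <= y by rewrite mulr_ge0 ?divr_ge0.
have step k : (k < p.+1 - v)%N ->
    (expR 1 * b * v%:R ^+ 2 / (k + v)%:R) ^+ k <= (y ^+ k / k`!%:R) ^+ 2.
  move=> kp; have kvp : (k + v <= p)%N by lia.
  have kv0 : (0 < k + v)%N by rewrite addn_gt0 orbC (leq_trans _ v3).
  apply: (@le_trans _ _ ((y ^+ 2 / (p%:R * (k + v)%:R)) ^+ k)).
    apply: lerXn2r; rewrite ?nnegrE.
    - by rewrite !(mulr_ge0, divr_ge0, exprn_ge0, expR_ge0, ler0n).
    - by rewrite !(mulr_ge0, divr_ge0, exprn_ge0, ler0n).
    rewrite invfM [leRHS]mulrA ler_wpM2r ?invr_ge0 ?ler0n // ler_pdivlMr ?ltr0n //.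
    by rewrite mulrAC /y exprMn ler_wpM2r // exprn_ge0.
  rewrite exprMn exprVn [leRHS]exprMn exprVn (exprAC y) ler_wpM2l ?exprn_ge0 //.
  rewrite lef_pV2 ?posrE ?exprn_gt0 ?mulr_gt0 ?ltr0n ?fact_gt0 //.
  rewrite -natrM -!natrX ler_nat expnMn -mulnn leq_mul //.
    apply: leq_trans (fact_le_expn k) _.
    by case: (k) kvp => // n ?; rewrite leq_exp2r //; lia.
  apply: leq_trans (fact_le_expn k) _.
  by case: (k) => // n; rewrite leq_exp2r // leq_addr.
apply: (@le_trans _ _ (\sum_(0 <= k < p.+1 - v) (y ^+ k / k`!%:R) ^+ 2)).
  by rewrite [leLHS]big_nat [leRHS]big_nat; apply: ler_sum => k /andP[_]; exact: step.
have t0 k : 0 <= y ^+ k / k`!%:R by rewrite divr_ge0 ?exprn_ge0.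
apply: (@le_trans _ _ (expR y ^+ 2)).
  apply: le_trans (sum_sqr_le_sqr_sum _ t0) _.
  by rewrite lerXn2r ?nnegrE ?sumr_ge0 ?expR_ge0 // exp_partial_sum_le.
(* Here 2y = l v / 3, and v/3 is at most (v - 1)/2 exactly when v is at least 3. *)
rewrite -!expRM_natl ler_expR /y.
have v1 : v.-1%:R = v%:R - 1 :> R by rewrite -subn1 natrB // (leq_trans _ v3).
have vR : 3 <= v%:R :> R by rewrite (ler_nat _ 3).
by rewrite v1; nra.
Qed.

Lemma geometric_sum_le (R : realFieldType) (c : R) (N : nat) :
  0 <= c -> c <= 2^-1 -> \sum_(0 <= k < N) c ^+ k <= 2.
Proof.
move=> c0 c2; suff : (1 - c) * \sum_(0 <= k < N) c ^+ k <= 1.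
  have : 0 <= \sum_(0 <= k < N) c ^+ k by rewrite sumr_ge0 // => k _; rewrite exprn_ge0.
  by nra.
rewrite big_mkord -opprB mulNr -subrX1 opprB gerBl exprn_ge0 //.
Qed.

(* The supports with two columns are paid for by E, the larger ones by a
   geometric series in g * sqrt X. *)
Lemma support_moment_series_le (R : realType) (J : finType) (a : J -> R)
    (b A E X : R) (p : nat) (g := expR 1 ^+ 2 * b * A) :
  (forall j, 0 <= a j) -> 0 <= b -> 0 < A -> \sum_j a j <= A -> 1 <= X ->
  expR (4 * expR 1 * b) <= E -> expR 1 * b * p%:R <= (ln X / 6) ^+ 2 ->
  g * X <= 2^-1 ->
  \sum_(q < p.+1) b ^+ q * support_moment a q / q`!%:R <=
  1 + g * (g * E + (2 * X)^-1).
Proof.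
move=> a0 b0 A0 aA X1 hE hX hg.
have X0 : 0 < X by apply: lt_le_trans X1.
have lX : 0 <= ln X by rewrite ln_ge0.
have g0 : 0 <= g by rewrite !mulr_ge0 ?exprn_ge0 ?expR_ge0 // ltW.
apply: le_trans (weighted_moment_sum_le p a0 b0 A0 aA) _; rewrite lerD2l -/g.
pose s := expR (ln X / 2).
have sX : s ^+ 2 = X.
  by rewrite /s -expRM_natl mulrC divfK ?pnatr_eq0 // lnK.
have s1 : 1 <= s by rewrite -expR0 ler_expR divr_ge0.
have s0 : 0 < s by apply: lt_le_trans s1.
case: (leqP p 1) => [p1|p2].
  rewrite big_geq //; apply: mulr_ge0 => //; apply: addr_ge0.
    by apply: mulr_ge0 => //; apply: le_trans hE; exact: expR_ge0.
  by rewrite invr_ge0 mulr_ge0 // ltW.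
rewrite big_ltn // mulrDr lerD //.
  rewrite [leRHS]mulrA -expr2 ler_wpM2l ?exprn_ge0 //; apply: le_trans hE.
  rewrite (_ : 4 * expR 1 * b = expR 1 * b * 2%:R ^+ 2); last by ring.
  by apply: two_slot_sum_le; rewrite !mulr_ge0 ?expR_ge0.
(* As [s] is the square root of [X], a support size [v] contributes at most g^v s^(v-1) = g c^(v-1),
   a geometric series starting at g c^2. *)
pose c := g * s.
have c0 : 0 <= c by rewrite mulr_ge0 // ltW.
have cs : c * s <= 2^-1 by rewrite /c -mulrA -expr2 sX.
have c2 : c <= 2^-1 by apply: le_trans cs; rewrite ler_peMr.
have cX : c ^+ 2 <= (4 * X)^-1.
  rewrite -[_^-1]mul1r ler_pdivlMr ?mulr_gt0 // -sX.
  rewrite [leLHS](_ : _ = (2 * (c * s)) ^+ 2); last by ring.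
  apply: exprn_ile1; first by rewrite !mulr_ge0 // ltW.
  by rewrite mulrC -ler_pdivlMr // mul1r.
apply: (@le_trans _ _ (\sum_(3 <= v < p.+1) g * (c ^+ 2 * c ^+ (v - 3)))).
  rewrite [leLHS]big_nat [leRHS]big_nat; apply: ler_sum => v /andP[v3 vp].
  case: v v3 vp => [|[|[|v]]] // v3 vp.
  have -> : g * (c ^+ 2 * c ^+ (v.+3 - 3)) = g ^+ v.+3 * s ^+ v.+2.
    by rewrite -[v.+3 in LHS]addn3 addnK -exprD exprMn mulrA -exprS.
  by rewrite ler_wpM2l ?exprn_ge0 // many_slot_sum_le.
rewrite -mulr_sumr -mulr_sumr ler_wpM2l //.
rewrite -{1}[3%N]add0n big_addn; under eq_bigr do rewrite addnK.
apply: le_trans (ler_wpM2l _ (geometric_sum_le _ c0 c2)) _; first by rewrite exprn_ge0.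
rewrite (_ : (2 * X)^-1 = (4 * X)^-1 * 2); last by field; rewrite gt_eqF.
by rewrite ler_wpM2r.
Qed.

(** * Tail bound for a single vector *)

(** The weights [a j] sum to at most 1 / (m nu^2), and evaluating the generating function at
    [b = lam * nu ^+ 2] absorbs the factor [nu ^+ (2 * p)]. *)
Lemma distortion_moment_exp_le (R : realType) (J : finType) (m p : nat)
    (x : J -> R) (nu lam E X : R) (b := lam * nu ^+ 2)
    (g := expR 1 ^+ 2 * lam / m%:R) :
  (0 < m)%N -> 0 < nu -> 0 < lam -> 1 <= X ->
  (forall j, `|x j| <= nu) -> \sum_j x j ^+ 2 <= 1 ->
  expR (4 * expR 1 * b) <= E -> expR 1 * b * p%:R <= (ln X / 6) ^+ 2 ->
  g * X <= 2^-1 -> g * (g * E + (2 * X)^-1) <= p%:R / m%:R ->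
  \sum_(f : {ffun J -> 'I_m * bool}) distortion x f ^+ p <=
  (2 * m)%:R ^+ #|J| * (p`!%:R / lam ^+ p * expR p%:R).
Proof.
move=> m0 nu0 lam0 X1 xnu x1 hE hX hg hm.
apply: le_trans (distortion_moment_le p m0 nu0 xnu) _.
rewrite ler_wpM2l ?exprn_ge0 ?ler0n //.
set a := fun j => x j ^+ 2 / (m%:R * nu ^+ 2).
have mR : 0 < m%:R :> R by rewrite ltr0n.
have nu2 : 0 < nu ^+ 2 by rewrite exprn_gt0.
have A0 : 0 < (m%:R * nu ^+ 2)^-1 by rewrite invr_gt0 mulr_gt0.
have a0 j : 0 <= a j by rewrite mulr_ge0 ?sqr_ge0 // ltW.
have aA : \sum_j a j <= (m%:R * nu ^+ 2)^-1 by rewrite -mulr_suml ler_piMl // ltW.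
have b0 : 0 < b by rewrite mulr_gt0.
have gE : expR 1 ^+ 2 * b * (m%:R * nu ^+ 2)^-1 = g.
  by rewrite /g /b; field; rewrite !gt_eqF.
have := @support_moment_series_le R J a b _ E X p a0 (ltW b0) A0 aA X1 hE hX.
rewrite gE => /(_ hg) series.
have fiber := sum_prod_fiber_le m p (fun q => support_moment_ge0 q a0) (ltW b0).
have -> : nu ^+ (2 * p) = b ^+ p / lam ^+ p.
  by rewrite /b exprMn -exprM mulrAC mulfV ?mul1r // expf_neq0 // gt_eqF.
rewrite mulrAC -[leRHS]mulrAC ler_wpM2r ?invr_ge0 ?exprn_ge0 ?(ltW lam0) //.
apply: (le_trans fiber); rewrite ler_wpM2l ?ler0n //.
have S0 : 0 <= \sum_(q < p.+1) b ^+ q * support_moment a q / q`!%:R.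
  rewrite sumr_ge0 // => q _.
  by rewrite divr_ge0 ?mulr_ge0 ?exprn_ge0 ?support_moment_ge0 ?ler0n ?(ltW b0).
(* It remains to use that (1 + p/m)^m is at most e^p. *)
rewrite -[p%:R](divfK (_ : m%:R != 0)) ?gt_eqF // mulrC expRM_natl.
rewrite lerXn2r ?nnegrE ?expR_ge0 //; apply: (le_trans series).
by apply: le_trans (expR_ge1Dx _); rewrite lerD2l.
Qed.

(* For lam = 2 e^2 p / eps, this value of C2 makes the number g * X of
   support_moment_series_le at most 1/2. *)
Definition hash_C2 (R : realType) : R := (36 * expR 1 ^+ 4)^-1.

Lemma distortion_moment_tail (R : realType) (J : finType) (m p : nat)
    (x : J -> R) (eps E L : R) (C2 := hash_C2 R)
    (nu := 9^-1 * Num.sqrt C2 * Num.sqrt eps *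
       Num.min (ln (E / (C2 * eps)) / L) (Num.sqrt (ln E / L))) :
  (0 < m)%N -> (0 < p)%N -> 0 < eps < 1 -> expR 1 <= E -> 0 < L -> p%:R <= 9 * L ->
  E * C2 ^- 2 * eps ^- 2 * L <= m%:R ->
  (forall j, `|x j| <= nu) -> \sum_j x j ^+ 2 <= 1 ->
  \sum_(f : {ffun J -> 'I_m * bool}) distortion x f ^+ p <=
  (2 * m)%:R ^+ #|J| * ((eps / 2) ^+ p * expR (- p%:R)).
Proof.
move=> m0 p0 /andP[eps0 eps1] Ee L0 pL mE xnu x1.
have e2 : 2 <= expR 1 :> R by exact: expR_ge1Dx.
have c18 : 18 * 36^-1 <= 2^-1 :> R by clear; lra.
have c1 : 18^-1 <= 1 :> R by clear; lra.
have c4 : 4 * (81^-1 * 9) <= 1 :> R by clear; lra.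
have c81 : 9 ^+ 2 * 81^-1 = 1 :> R by clear; field.
set e := expR 1 in e2 Ee *.
have e1 : 1 <= e by apply: le_trans e2; rewrite ler1n.
have e0 : 0 < e := lt_le_trans ltr01 e1.
have C2E : C2 = (36 * e ^+ 4)^-1 by [].
have C20 : 0 < C2 by rewrite C2E invr_gt0 mulr_gt0 // exprn_gt0.
have C21 : C2 <= 1.
  rewrite C2E invf_le1 ?mulr_gt0 ?exprn_gt0 // mulr_ege1 ?ler1n //.
  by rewrite exprn_ege1.
have E1 : 1 <= E := le_trans e1 Ee.
have E0 : 0 < E := lt_le_trans ltr01 E1.
have e40 : 0 <= e ^+ 4 by rewrite exprn_ge0 // ltW.
(* [k] is the factor left in [lam * nu ^+ 2] besides p mu^2 / 81 and 1/e. The bound 1/36 pays for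
   the 6 in [(ln X / 6) ^+ 2]. *)
pose k := (18 * e)^-1.
have k0 : 0 < k by rewrite invr_gt0 mulr_gt0.
have k36 : k <= 36^-1.
  rewrite lef_pV2 ?posrE ?mulr_gt0 //.
  by move: e2; clearbody e; clear; lra.
have k1 : k <= 1 by move: k36; clearbody k; clear; lra.
set X := E / (C2 * eps) in nu xnu *.
have C2eps : 0 < C2 * eps by rewrite mulr_gt0.
have X_ge : E <= X by rewrite ler_pdivlMr // ler_piMr ?(ltW E0) // mulr_ile1 // ltW.
have X0 : 0 < X := lt_le_trans E0 X_ge.
have lnE0 : 0 < ln E by rewrite (lt_le_trans ltr01) // -(expRK (1 : R)) ler_ln ?posrE.
have lnX0 : 0 < ln X by rewrite (lt_le_trans lnE0) // ler_ln ?posrE.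
set mu := Num.min _ _ in nu xnu.
have mu0 : 0 < mu by rewrite lt_min sqrtr_gt0 !divr_gt0.
have muX : mu * L <= ln X by rewrite -ler_pdivlMr // ge_min lexx.
have muE : mu ^+ 2 * L <= ln E.
  rewrite -ler_pdivlMr // -[leRHS]sqr_sqrtr ?divr_ge0 ?(ltW L0) ?(ltW lnE0) //.
  by rewrite lerXn2r ?nnegrE ?(ltW mu0) ?sqrtr_ge0 // ge_min lexx orbT.
have pR : 0 < p%:R :> R by rewrite ltr0n.
have mR : 0 < m%:R :> R by rewrite ltr0n.
have pmu : p%:R * mu <= 9 * ln X.
  apply: (@le_trans _ _ (9 * L * mu)); first by rewrite ler_wpM2r // ltW.
  by rewrite -mulrA ler_wpM2l // mulrC.
have pmu2 : p%:R * mu ^+ 2 <= 9 * ln E.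
  apply: (@le_trans _ _ (9 * L * mu ^+ 2)); first by rewrite ler_wpM2r ?sqr_ge0.
  by rewrite -mulrA ler_wpM2l // mulrC.
have nu0 : 0 < nu by rewrite !mulr_gt0 // ?sqrtr_gt0.
have nuE : nu ^+ 2 = C2 * eps * mu ^+ 2 / 81.
  rewrite /nu !exprMn !sqr_sqrtr ?(ltW C20) ?(ltW eps0) //.
  by field.
(* Since p! is at most p^p, this choice makes p! e^p / lam^p at most (eps/2)^p e^(-p). *)
pose lam := 2 * e ^+ 2 * p%:R / eps.
have lam0 : 0 < lam by rewrite divr_gt0 // !mulr_gt0 // exprn_gt0.
have bE : lam * nu ^+ 2 = p%:R * mu ^+ 2 * 81^-1 * k / e.
  by rewrite nuE C2E /lam /k; field; rewrite !gt_eqF.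
have gE : e ^+ 2 * lam / m%:R = 2 * e ^+ 4 * p%:R / (eps * m%:R).
  by rewrite /lam; field; rewrite !gt_eqF.
have g0 : 0 < e ^+ 2 * lam / m%:R by rewrite !mulr_gt0 ?exprn_gt0 ?invr_gt0.
have gX : e ^+ 2 * lam / m%:R * X <= 2^-1.
  rewrite gE /X mulf_div ler_pdivrMr ?mulr_gt0 //.
  have Em : E * L <= m%:R * (C2 ^+ 2 * eps ^+ 2).
    rewrite -ler_pdivrMr ?mulr_gt0 ?exprn_gt0 //.
    by rewrite invfM (_ : E * L * _ = E * C2 ^- 2 * eps ^- 2 * L) //; ring.
  have C2e : C2 * e ^+ 4 = 36^-1 by rewrite C2E; field; rewrite gt_eqF.
  have pE : 2 * e ^+ 4 * p%:R * E <= 18 * e ^+ 4 * (E * L).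
    rewrite (_ : 18 * _ * _ = 2 * e ^+ 4 * (9 * L) * E); last by ring.
    by rewrite ler_wpM2r ?(ltW E0) // ler_wpM2l // mulr_ge0.
  apply: (le_trans pE); apply: (@le_trans _ _ (18 * e ^+ 4 * (m%:R * (C2 ^+ 2 * eps ^+ 2)))).
    by rewrite ler_wpM2l // mulr_ge0.
  rewrite (_ : 18 * _ * _ = 18 * (C2 * e ^+ 4) * (eps * m%:R * (C2 * eps))); last by ring.
  by rewrite C2e ler_wpM2r // !mulr_ge0 // ltW.
have := @distortion_moment_exp_le R J m p x nu lam E X m0 nu0 lam0 _ xnu x1.
rewrite -/e bE.
move=> tail; apply: (le_trans (tail _ _ _ _ _)) => {tail} //.
- exact: le_trans E1 X_ge.
(* Supports of size two: the square root in the minimum gives this bound. *)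
- rewrite -[leRHS](lnK E0) ler_expR.
  rewrite [leLHS](_ : _ = 4 * (81^-1 * (p%:R * mu ^+ 2)) * k); last first.
    by field; rewrite gt_eqF.
  apply: (@le_trans _ _ (4 * (81^-1 * (9 * ln E)) * k)).
    by rewrite ler_wpM2r ?(ltW k0) // !ler_wpM2l.
  rewrite [_ * (9 * _)]mulrA [4 * _]mulrA mulrAC ler_piMl ?(ltW lnE0) //.
  by rewrite mulr_ile1 // ltW.
(* Larger supports: the logarithm in the minimum gives this bound. *)
- rewrite [leLHS](_ : _ = (p%:R * mu) ^+ 2 * 81^-1 * k); last first.
    by field; rewrite gt_eqF.
  apply: (@le_trans _ _ ((9 * ln X) ^+ 2 * 81^-1 * k)).
    rewrite ler_wpM2r ?(ltW k0) // ler_wpM2r //.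
    by rewrite lerXn2r ?nnegrE ?mulr_ge0 // ltW.
  rewrite exprMn [_ * 81^-1]mulrAC c81 mul1r exprMn exprVn -natrX.
  by rewrite ler_wpM2l ?sqr_ge0.
(* Both summands are at most C2 eps / 2, and g C2 eps equals p / (18 m). *)
- have gle : e ^+ 2 * lam / m%:R * E <= C2 * eps / 2.
    have -> : E = X * (C2 * eps) by rewrite /X divfK // gt_eqF.
    by rewrite mulrA [leRHS]mulrC ler_wpM2r // ltW.
  have Xle : (2 * X)^-1 <= C2 * eps / 2.
    rewrite invfM mulrC ler_wpM2r // /X invf_div ler_pdivrMr //.
    by rewrite ler_peMr // ltW.
  apply: (@le_trans _ _ (e ^+ 2 * lam / m%:R * (C2 * eps))).
    by rewrite ler_wpM2l ?(ltW g0) // [leRHS]splitr lerD.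
  rewrite gE [leLHS](_ : _ = 18^-1 * (p%:R / m%:R)).
    by rewrite ler_piMl // divr_ge0 // ltW.
  by rewrite C2E; field; rewrite !gt_eqF.
rewrite ler_wpM2l ?exprn_ge0 ?ler0n //.
have pf : p`!%:R <= p%:R ^+ p :> R by rewrite -natrX ler_nat fact_le_expn.
apply: (@le_trans _ _ (p%:R ^+ p / lam ^+ p * expR p%:R)).
  by rewrite !ler_wpM2r ?expR_ge0 ?invr_ge0 ?exprn_ge0 ?(ltW lam0).
have expp : expR p%:R = e ^+ p by rewrite -expRM_natl mulr1.
rewrite expRN expp.
rewrite -!exprVn -!exprMn le_eqVlt; apply/orP; left; apply/eqP; congr (_ ^+ _).
by rewrite /lam; field; rewrite !gt_eqF.
Qed.

(** * Quadratic forms and a grid in the unit ball *)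

Definition quad_form (R : pzRingType) (r : nat) (M : 'M[R]_r) (y : 'cV[R]_r) : R :=
  (y^T *m M *m y) 0 0.

Lemma quad_form_comb (R : comPzRingType) (r : nat) (M : 'M[R]_r) (y z : 'cV[R]_r) (a b : R) :
  M^T = M ->
  quad_form M (a *: y + b *: z) =
  a ^+ 2 * quad_form M y + 2 * a * b * (y^T *m M *m z) 0 0 + b ^+ 2 * quad_form M z.
Proof.
move=> symM; have sym : (z^T *m M *m y) 0 0 = (y^T *m M *m z) 0 0.
  suff -> : z^T *m M *m y = (y^T *m M *m z)^T by rewrite mxE.
  by rewrite !trmx_mul trmxK symM mulmxA.
rewrite /quad_form; have addE (A B : 'M[R]_1) : (A + B) 0 0 = A 0 0 + B 0 0 by rewrite mxE.
have scaleE c (A : 'M[R]_1) : (c *: A) 0 0 = c * A 0 0 by rewrite mxE.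
have -> : (a *: y + b *: z)^T = a *: y^T + b *: z^T by rewrite linearD /= !linearZ.
rewrite !mulmxDl !mulmxDr -!scalemxAl -!scalemxAr.
by rewrite !addE !scaleE sym; ring.
Qed.

Lemma quad_form1 (R : pzRingType) (r : nat) (y : 'cV[R]_r) :
  quad_form 1%:M y = \sum_i y i 0 ^+ 2.
Proof. by rewrite /quad_form mulmx1 mxE; apply: eq_bigr => i _; rewrite mxE expr2. Qed.

(** With this mesh, rounding all [r] coordinates moves a vector by at most 1/5. *)
Definition grid_step (R : realType) (r : nat) : R := (5 * Num.sqrt r%:R)^-1.

Definition grid_size (R : realType) (r : nat) : nat := Num.truncn ((grid_step R r)^-1).

Definition grid_point (R : realType) (r : nat)
    (g : {ffun 'I_r -> bool * 'I_(grid_size R r).+1}) : 'cV[R]_r :=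
  \col_i ((-1) ^+ (g i).1 * ((g i).2%:R * grid_step R r)).

Definition in_unit_ball (R : realType) (r : nat)
    (g : {ffun 'I_r -> bool * 'I_(grid_size R r).+1}) : bool :=
  quad_form 1%:M (grid_point g) <= 1.

Lemma grid_step_gt0 (R : realType) (r : nat) : (0 < r)%N -> 0 < grid_step R r.
Proof. by move=> r0; rewrite invr_gt0 mulr_gt0 // sqrtr_gt0 ltr0n. Qed.

Lemma grid_step_sqr (R : realType) (r : nat) :
  (0 < r)%N -> grid_step R r ^+ 2 = (25 * r%:R)^-1.
Proof.
move=> r0; rewrite /grid_step exprVn exprMn sqr_sqrtr ?ler0n //.
by congr (_ * _)^-1; ring.
Qed.

(** Round every coordinate towards zero: no absolute value grows, so the grid point stays in the
    ball. *)
Lemma grid_approx (R : realType) (r : nat) (y : 'cV[R]_r) :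
  (0 < r)%N -> quad_form 1%:M y <= 1 ->
  exists g : {ffun 'I_r -> bool * 'I_(grid_size R r).+1},
    in_unit_ball g /\ quad_form 1%:M (1 *: y + -1 *: grid_point g) <= 25^-1.
Proof.
move=> r0 y1; set h := grid_step R r; have h0 : 0 < h by exact: grid_step_gt0.
have yle i : `|y i 0| <= 1.
  rewrite -(expr_le1 (isT : (0 < 2)%N)) // real_normK ?num_real //.
  apply: le_trans y1; rewrite quad_form1 (bigD1 i) //= lerDl sumr_ge0 // => j _.
  exact: sqr_ge0.
pose a i := Num.truncn (`|y i 0| / h).
have ah i : (a i)%:R * h <= `|y i 0|.
  by rewrite -ler_pdivlMr // truncn_le // divr_ge0 // ltW.
have aH i : `|y i 0| <= (a i)%:R * h + h.
  rewrite -[X in _ + X]mul1r -mulrDl -ler_pdivrMr // ltW //.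
  by rewrite natr1 truncnS_gt.
have aK i : (a i < (grid_size R r).+1)%N.
  by rewrite ltnS /a /grid_size le_truncn // ler_piMl // invr_ge0 ltW.
pose g : {ffun 'I_r -> bool * 'I_(grid_size R r).+1} :=
  [ffun i => (y i 0 < 0, Ordinal (aK i))].
have gE i : grid_point g i 0 = (-1) ^+ (y i 0 < 0)%R * ((a i)%:R * h).
  by rewrite mxE ffunE.
have yE i : y i 0 = (-1) ^+ (y i 0 < 0)%R * `|y i 0|.
  by rewrite -realEsign ?num_real.
exists g; split.
  rewrite /in_unit_ball; apply: le_trans y1; rewrite !quad_form1; apply: ler_sum => i _.
  rewrite gE exprMn sqrr_sign mul1r -[leRHS]real_normK ?num_real //.
  by rewrite lerXn2r ?nnegrE ?mulr_ge0 // ltW.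
rewrite quad_form1; apply: (@le_trans _ _ (\sum_(i < r) h ^+ 2)); last first.
  by rewrite sumr_const card_ord grid_step_sqr // -[_ *+ r]mulr_natr invfM divfK // pnatr_eq0 -lt0n.
apply: ler_sum => i _.
have -> : (1 *: y + -1 *: grid_point g) i 0 = y i 0 - grid_point g i 0.
  by rewrite scale1r scaleN1r !mxE.
rewrite gE {1}yE -mulrBr exprMn sqrr_sign mul1r.
by rewrite lerXn2r ?nnegrE ?subr_ge0 // ?(ltW h0) // lerBlDl.
Qed.

(* A grid point of the unit ball has sum_i c_i^2 <= 25 r, so the number of them
   is at most e^(25 r) times a sum that factors over the coordinates. *)
Lemma card_grid_le (R : realType) (r : nat) :
  (0 < r)%N ->
  #|[pred g : {ffun 'I_r -> bool * 'I_(grid_size R r).+1} | in_unit_ball g]|%:R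
  <= expR (27 * r%:R) :> R.
Proof.
move=> r0; have h0 := grid_step_gt0 R r0.
have rR : 0 < r%:R :> R by rewrite ltr0n.
rewrite -sum1_card natr_sum big_mkcond.
apply: (@le_trans _ _ (\sum_(g : {ffun 'I_r -> bool * 'I_(grid_size R r).+1})
   expR (25 * r%:R) * \prod_i expR (- ((g i).2%:R ^+ 2)))).
  apply: ler_sum => g _; rewrite -expR_sum -expRD.
  case: ifP => [|_]; last exact: expR_ge0.
  rewrite inE /in_unit_ball quad_form1 => g1; rewrite -[leLHS]expR0 ler_expR.
  rewrite sumrN subr_ge0; move: g1; under eq_bigr do rewrite mxE exprMn sqrr_sign mul1r exprMn.
  rewrite -mulr_suml grid_step_sqr // ler_pdivrMr ?mulr_gt0 // mul1r.
  by apply: le_trans; exact: lexx.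
rewrite -mulr_sumr -(bigA_distr_bigA
  (fun _ (c : bool * 'I_(grid_size R r).+1) => expR (- (c.2%:R ^+ 2)))).
rewrite prodr_const card_ord -(pair_bigA _
  (fun (_ : bool) (c : 'I_(grid_size R r).+1) => expR (- (c%:R ^+ 2)))) /=.
rewrite big_bool /= -mulr2n -[_ *+ 2]mulr_natl.
(* Each coordinate contributes two signs times a geometric sum of at most 2, hence at most 4, which
   is below e^2. *)
rewrite (_ : 27 * r%:R = 25 * r%:R + r%:R * 2); last by ring.
rewrite expRD ler_wpM2l ?expR_ge0 // expRM_natl.
have e2 : 2 <= expR 1 :> R by exact: expR_ge1Dx.
have S0 : 0 <= \sum_(c < (grid_size R r).+1) expR (- (c%:R ^+ 2)) :> R.
  by rewrite sumr_ge0 // => c _; rewrite expR_ge0.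
rewrite lerXn2r ?nnegrE ?expR_ge0 ?mulr_ge0 //.
apply: (@le_trans _ _ (2 * 2)); last first.
  rewrite (_ : expR 2 = expR 1 * expR 1); last by rewrite -expRD.
  by rewrite ler_pM.
rewrite ler_pM2l //.
have c2 : expR (- 1) <= 2^-1 :> R by rewrite expRN lef_pV2 ?posrE ?expR_gt0.
apply: le_trans (geometric_sum_le (grid_size R r).+1 (expR_ge0 _) c2).
rewrite big_mkord; apply: ler_sum => c _; rewrite -expRM_natl ler_expR mulrN1 lerN2.
by rewrite -natrX ler_nat; case: (nat_of_ord c) => // k; rewrite -mulnn leq_pmulr.
Qed.

(** Let [k] be the supremum of the form on the unit ball. Moving a point to the grid changes the
    form by at most k/2, so k is at most T + k/2. *)
Lemma quad_form_le_of_net (R : realType) (r : nat) (M : 'M[R]_r) (T : R) (y : 'cV[R]_r) :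
  (0 < r)%N -> M^T = M ->
  (forall g : {ffun 'I_r -> bool * 'I_(grid_size R r).+1},
     in_unit_ball g -> `|quad_form M (grid_point g)| <= T) ->
  `|quad_form M y| <= 2 * T * quad_form 1%:M y.
Proof.
move=> r0 symM netT.
have sym1 : (1%:M : 'M[R]_r)^T = 1%:M by rewrite trmx1.
have sq0 (z : 'cV[R]_r) : 0 <= quad_form 1%:M z.
  by rewrite quad_form1 sumr_ge0 // => i _; rewrite sqr_ge0.
have quadZ (N : 'M[R]_r) c z : N^T = N -> quad_form N (c *: z) = c ^+ 2 * quad_form N z.
  move=> symN; have := quad_form_comb z z c 0 symN.
  by rewrite scale0r addr0 expr0n !mul0r mulr0 mul0r !addr0.
pose S : set R := [set t | exists2 z, quad_form 1%:M z <= 1 & t = `|quad_form M z|]%classic.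
have S0 : S 0.
  exists 0; rewrite ?quad_form1 /quad_form ?mulmx0 ?mxE ?normr0 //.
  by rewrite big1 // => i _; rewrite mxE expr0n.
have supS : has_sup S.
  split; first by exists 0.
  exists (\sum_i \sum_j `|M j i|) => t [z z1 ->]; rewrite /quad_form mxE.
  have zle i : `|z i 0| <= 1.
    rewrite -(expr_le1 (isT : (0 < 2)%N)) // real_normK ?num_real //.
    apply: le_trans z1; rewrite quad_form1 (bigD1 i) //= lerDl sumr_ge0 // => j _.
    exact: sqr_ge0.
  apply: le_trans (ler_norm_sum _ _ _) _; apply: ler_sum => i _; rewrite mxE normrM.
  apply: (@le_trans _ _ (`|\sum_j z^T 0 j * M j i| * 1)); first by rewrite ler_wpM2l.
  rewrite mulr1; apply: le_trans (ler_norm_sum _ _ _) _; apply: ler_sum => j _.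
  by rewrite mxE normrM ler_piMl.
set k := sup S.
have k0 : 0 <= k by exact: sup_upper_bound.
have kle z : `|quad_form M z| <= k * quad_form 1%:M z.
  have [z0|z_neq0] := eqVneq (quad_form 1%:M z) 0.
    suff -> : z = 0 by rewrite {1}/quad_form mulmx0 mxE normr0 mulr_ge0.
    apply/colP => i; apply/eqP; rewrite mxE -sqrf_eq0; move/eqP: z0.
    by rewrite quad_form1 psumr_eq0 => [/allP/(_ i (mem_index_enum _))//|j _]; rewrite sqr_ge0.
  have z_gt0 : 0 < quad_form 1%:M z by rewrite lt_def z_neq0 sq0.
  rewrite -ler_pdivrMr //; apply: sup_upper_bound => //.
  exists ((Num.sqrt (quad_form 1%:M z))^-1 *: z).
    by rewrite quadZ // exprVn sqr_sqrtr // mulVf.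
  by rewrite quadZ // exprVn sqr_sqrtr // normrM mulrC normfV (ger0_norm (sq0 z)).
suff k2 : k <= 2 * T by apply: le_trans (kle y) _; rewrite ler_wpM2r.
suff : k <= T + k / 2 by lra.
apply: sup_le_ub; first by exists 0.
move=> _ [{}y y1 ->]; have [g [g1 gy]] := grid_approx r0 y1.
have := netT g g1; move: g1 gy; rewrite /in_unit_ball; set z := grid_point g => z1 yz Tz.
(* Polarization of <y - z, M (y + z)> with weights 3 and 1/3, to take advantage
   of y - z being small. *)
have polar : quad_form M y - quad_form M z =
    4^-1 * (quad_form M ((10 / 3) *: y + (- 8 / 3) *: z)
            - quad_form M ((8 / 3) *: y + (- 10 / 3) *: z)).
  by rewrite !quad_form_comb //; field.
have n1 := kle ((10 / 3) *: y + (- 8 / 3) *: z).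
have n2 := kle ((8 / 3) *: y + (- 10 / 3) *: z).
(* The left side equals 160/9 |y - z|^2 + 4/9 (|y|^2 + |z|^2), at most 8/5. *)
have sum_le : quad_form 1%:M ((10 / 3) *: y + (- 8 / 3) *: z) +
    quad_form 1%:M ((8 / 3) *: y + (- 10 / 3) *: z) <= 2.
  by move: yz; rewrite !quad_form_comb //; lra.
have : `|quad_form M y - quad_form M z| <= k / 2.
  rewrite polar normrM ger0_norm ?invr_ge0 //.
  apply: (@le_trans _ _ (4^-1 * (k * 2))); last by lra.
  rewrite ler_pM2l ?invr_gt0 //; apply: le_trans (ler_normB _ _) _.
  by apply: le_trans (lerD n1 n2) _; rewrite -mulrDr ler_wpM2l.
by have := ler_normD (quad_form M z) (quad_form M y - quad_form M z); rewrite addrC subrK; lra.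
Qed.

(** * Law of the hash configuration *)

Local Open Scope classical_set_scope.

Definition hash_config (Omega : Type) (m n s : nat)
    (h : 'I_n -> 'I_s -> Omega -> 'I_m) (b : 'I_n -> 'I_s -> Omega -> bool)
    (w : Omega) : {ffun 'I_n * 'I_s -> 'I_m * bool} :=
  [ffun jk => (h jk.1 jk.2 w, b jk.1 jk.2 w)].

Section HashConfig.
Context (R : realType) (disp : measure_display) (Omega : measurableType disp)
  (P : probability Omega R) (m n s : nat)
  (h : 'I_n -> 'I_s -> Omega -> 'I_m) (b : 'I_n -> 'I_s -> Omega -> bool).
Hypotheses (uh : forall j k, discrete_uniform P (h j k))
  (ub : forall j k, discrete_uniform P (b j k))
  (ind : mutually_independent P (draw h b)).

Definition config_value (f : {ffun 'I_n * 'I_s -> 'I_m * bool})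
    (u : draw_index n s) : draw_type m u :=
  match u with inl jk => (f jk).1 | inr jk => (f jk).2 end.

Lemma preimage_hash_config (f : {ffun 'I_n * 'I_s -> 'I_m * bool}) :
  hash_config h b @^-1` [set f] =
  \bigcap_(u in [set` [set: draw_index n s]%SET]) draw h b u @^-1` [set config_value f u].
Proof.
apply/seteqP; split => w /=.
  by move=> <- [] jk _ /=; rewrite ffunE.
move=> hw; apply/ffunP => jk; rewrite ffunE.
have := hw (inl jk) (finset.in_setT _); have := hw (inr jk) (finset.in_setT _).
by move=> /= -> ->; case: (f jk).
Qed.

Lemma draw_uniform (u : draw_index n s) : discrete_uniform P (draw h b u).
Proof. by case: u => -[j k]; [exact: uh | exact: ub]. Qed.

Lemma measurable_hash_config f : measurable (hash_config h b @^-1` [set f]).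
Proof.
rewrite preimage_hash_config; apply: fin_bigcap_measurable => // u _.
by have [] := draw_uniform (config_value f u).
Qed.

Lemma prob_hash_config f :
  P (hash_config h b @^-1` [set f]) = (((2 * m)%:R ^+ #|{: 'I_n * 'I_s}|)^-1)%:E.
Proof.
rewrite preimage_hash_config ind.
rewrite (eq_bigr (fun u => (#|draw_type m u|%:R^-1)%:E)) => [|u _]; last first.
  by have [_ ->] := draw_uniform (config_value f u).
rewrite prodEFin; congr (_%:E).
rewrite (eq_bigl xpredT) => [|u]; last exact: finset.in_setT.
rewrite big_sumType /= !prodr_const card_ord card_bool.
by rewrite natrM exprMn invfM !exprVn mulrC.
Qed.

(** The configuration is uniformly distributed, so probabilities become proportions of
    configurations and the rest of the argument is counting. *)
Lemma prob_hash_config_pred (G : pred {ffun 'I_n * 'I_s -> 'I_m * bool}) :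
  P [set w | G (hash_config h b w)] =
  (#|[pred f | G f]|%:R / (2 * m)%:R ^+ #|{: 'I_n * 'I_s}|)%:E.
Proof.
set r := enum [pred f | G f].
have -> : [set w | G (hash_config h b w)] =
    \bigcup_(f in [set` r]) hash_config h b @^-1` [set f].
  apply/seteqP; split => [w Gw|w [f fr /= ->]].
    by exists (hash_config h b w) => //=; rewrite mem_enum.
  by move: fr; rewrite /= mem_enum.
rewrite measure_fin_bigcup //; last by move=> f _; exact: measurable_hash_config.
  rewrite -fsbig_seq ?enum_uniq // (eq_bigr _ (fun f _ => prob_hash_config f)).
  by rewrite sumEFin /r big_enum /= sumr_const mulr_natl.
apply/trivIsetP => f g _ _ fg; apply/seteqP; split => w //= [fw gw].
by move: fg; rewrite -fw -gw eqxx.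
Qed.
End HashConfig.

(** * Union bound *)

Lemma norm2_sqr (R : realType) (n : nat) (v : 'cV[R]_n) :
  norm2 v ^+ 2 = quad_form 1%:M v.
Proof.
by rewrite quad_form1 sqr_sqrtr // sumr_ge0 // => i _; exact: sqr_ge0.
Qed.

Lemma quad_form1_isometry (R : comPzRingType) (n r : nat) (U : 'M[R]_(n, r)) (y : 'cV[R]_r) :
  U^T *m U = 1%:M -> quad_form 1%:M (U *m y) = quad_form 1%:M y.
Proof.
move=> UU; rewrite /quad_form !mulmx1 trmx_mul -mulmxA [U^T *m _]mulmxA UU.
by rewrite mul1mx.
Qed.

Definition hash_mx (R : realType) (m n s : nat)
    (f : {ffun 'I_n * 'I_s -> 'I_m * bool}) : 'M[R]_(m, n) :=
  \matrix_(i, j) \sum_(k < s | (f (j, k)).1 == i) (-1) ^+ (f (j, k)).2 / Num.sqrt s%:R.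

Definition gram_defect (R : pzRingType) (m r : nat) (B : 'M[R]_(m, r)) : 'M[R]_r :=
  B^T *m B - 1%:M.

Lemma quad_form_gram_defect (R : comPzRingType) (m r : nat) (B : 'M[R]_(m, r)) (y : 'cV[R]_r) :
  quad_form (gram_defect B) y = quad_form 1%:M (B *m y) - quad_form 1%:M y.
Proof.
rewrite /quad_form /gram_defect mulmxBr mulmxBl !mulmx1 trmx_mul !mulmxA.
by rewrite mxE [in X in _ + X]mxE.
Qed.

(** Each coordinate of [U *m y] is split into [s] equal copies scaled by 1 / sqrt s, one per sample,
    which preserves the norm. *)
Lemma quad_form_hash_defect (R : realType) (m n s r : nat)
    (f : {ffun 'I_n * 'I_s -> 'I_m * bool}) (U : 'M[R]_(n, r)) (y : 'cV[R]_r) :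
  (0 < s)%N -> U^T *m U = 1%:M ->
  quad_form (gram_defect (hash_mx R f *m U)) y =
  distortion (fun jk => (U *m y) jk.1 0 / Num.sqrt s%:R) f.
Proof.
move=> s0 UU; rewrite quad_form_gram_defect -mulmxA -(quad_form1_isometry y UU).
rewrite !quad_form1 /distortion; congr (_ - _); last first.
  rewrite -(pair_bigA _ (fun j (k : 'I_s) => ((U *m y) j 0 / Num.sqrt s%:R) ^+ 2)) /=.
  apply: eq_bigr => j _; rewrite sumr_const card_ord exprMn exprVn sqr_sqrtr ?ler0n //.
  by rewrite -[_ *+ s]mulr_natr divfK // pnatr_eq0 -lt0n.
apply: eq_bigr => i _; rewrite [X in X ^+ 2]mxE; congr (_ ^+ 2).
set x := fun jk : 'I_n * 'I_s => (U *m y) jk.1 0 / Num.sqrt s%:R.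
have -> : \sum_p hash_entry x f i p = \sum_j \sum_k hash_entry x f i (j, k).
  by rewrite pair_bigA; apply: eq_bigr => -[].
apply: eq_bigr => j _; rewrite [X in X * _]mxE mulr_suml big_mkcond.
apply: eq_bigr => k _; rewrite /hash_entry /=.
by case: eqP => _; rewrite ?mul0r // mul1r mulrAC -mulrA.
Qed.

Lemma embedding_of_gram_defect (R : realType) (m n d r : nat) (eps : R)
    (S : 'M[R]_(m, n)) (U : 'M[R]_(n, r)) (B : 'M[R]_(r, d)) :
  U^T *m U = 1%:M ->
  (forall y, `|quad_form (gram_defect (S *m U)) y| <= eps * quad_form 1%:M y) ->
  subspace_embedding eps S (U *m B).
Proof.
move=> UU defect x; rewrite !norm2_sqr -!mulmxA quad_form1_isometry //.
have := defect (B *m x); rewrite quad_form_gram_defect -mulmxA ler_norml.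
by move=> /andP[h1 h2]; apply/andP; split; lra.
Qed.

(** Expand the nonnegative |a - c z|^2 with c the inner product of [a] and [z]. *)
Lemma cauchy_schwarz_unit (R : realFieldType) (I : finType) (a z : I -> R) :
  \sum_i z i ^+ 2 <= 1 -> (\sum_i a i * z i) ^+ 2 <= \sum_i a i ^+ 2.
Proof.
move=> z1.
have expand c : \sum_i (a i - c * z i) ^+ 2 =
    \sum_i a i ^+ 2 - 2 * c * \sum_i a i * z i + c ^+ 2 * \sum_i z i ^+ 2.
  rewrite !mulr_sumr -sumrB -big_split /=.
  by apply: eq_bigr => i _; ring.
set c := \sum_i a i * z i in expand *.
have : 0 <= \sum_i (a i - c * z i) ^+ 2 by rewrite sumr_ge0 // => i _; exact: sqr_ge0.
by rewrite expand; have := sqr_ge0 c; nra.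
Qed.

(** The coordinates of [U *m z] are inner products with rows of [U]; this turns the coherence
    hypothesis into the entrywise bound [nu]. *)
Lemma row_bound (R : realType) (n r : nat) (U : 'M[R]_(n, r)) (z : 'cV[R]_r) (j : 'I_n) :
  quad_form 1%:M z <= 1 -> `|(U *m z) j 0| <= max_row_norm U.
Proof.
rewrite quad_form1 => z1.
apply: (@le_trans _ _ (norm2 (row j U)^T)); last by rewrite /max_row_norm le_bigmax.
rewrite -(ler_pXn2r (isT : (0 < 2)%N)) ?nnegrE ?sqrtr_ge0 // real_normK ?num_real //.
rewrite norm2_sqr quad_form1 mxE.
have -> : \sum_(i < r) (row j U)^T i 0 ^+ 2 = \sum_i U j i ^+ 2.
  by apply: eq_bigr => i _; rewrite !mxE.
exact: cauchy_schwarz_unit.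
Qed.

Lemma card_embedding_ge (R : realType) (eps delta E : R) (s r d n m : nat) (C2 := hash_C2 R)
    (L := 4 * r%:R + ln (1 / delta)) (A : 'M[R]_(n, d))
    (U : 'M[R]_(n, r)) (B : 'M[R]_(r, d)) :
  0 < eps < 1 -> 0 < delta < 1 -> (0 < s)%N -> (0 < r)%N -> (0 < m)%N ->
  expR 1 <= E -> E * C2 ^- 2 * eps ^- 2 * L <= m%:R ->
  U^T *m U = 1%:M -> A = U *m B ->
  max_row_norm U <= mubar 9^-1 C2 E eps delta r * Num.sqrt s%:R ->
  (1 - delta) * (2 * m)%:R ^+ #|{: 'I_n * 'I_s}| <=
  #|[pred f : {ffun 'I_n * 'I_s -> 'I_m * bool} |
      `[< subspace_embedding eps (hash_mx R f) A >]]|%:R.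
Proof.
move=> eps01 /andP[delta0 delta1] s0 r0 m0 Ee mE UU AE mu_le.
have /andP[eps0 eps1] := eps01.
have lnd : ln delta < 0 by rewrite ln_lt0 // delta0.
have LE : L = 4 * r%:R - ln delta by rewrite /L ln_div ?posrE // ln1 sub0r.
have rR : 1 <= r%:R :> R by rewrite (ler_nat _ 1).
have L4 : 4 <= L by rewrite LE; lra.
have L0 : 0 < L by lra.
(* Evenness makes the moments nonnegative for Markov's inequality. The witness is at most 8 L + 2,
   hence at most 9 L because L is at least 4. *)
have [p [p0 p_even pl pL]] : exists p,
    [/\ (0 < p)%N, ~~ odd p, 8 * L <= p%:R & p%:R <= 9 * L].
  exists (2 * (Num.truncn (4 * L)).+1)%N; rewrite oddM.
  have trunc_le : (Num.truncn (4 * L))%:R <= 4 * L by rewrite truncn_le mulr_ge0 // ltW.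
  have trunc_gt : 4 * L < (Num.truncn (4 * L))%:R + 1 by rewrite natr1 truncnS_gt.
  by rewrite natrM -(natr1 (Num.truncn _)); split => //; lra.
pose Q (f : {ffun 'I_n * 'I_s -> 'I_m * bool})
    (g : {ffun 'I_r -> bool * 'I_(grid_size R r).+1}) :=
  quad_form (gram_defect (hash_mx R f *m U)) (grid_point g).
pose N : R := (2 * m)%:R ^+ #|{: 'I_n * 'I_s}|.
have moment g : in_unit_ball g -> \sum_f Q f g ^+ p <=
    N * ((eps / 2) ^+ p * expR (- p%:R)).
  move=> g1; under eq_bigr do rewrite /Q quad_form_hash_defect //.
  apply: (distortion_moment_tail (L := L) m0 p0 eps01 Ee L0 pL mE) => //.
    move=> [j k] /=; rewrite normrM normfV [`|Num.sqrt _|]ger0_norm ?sqrtr_ge0 //.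
    rewrite ler_pdivrMr ?sqrtr_gt0 ?ltr0n //.
    by apply: le_trans mu_le; exact: row_bound.
  rewrite -(pair_bigA _ (fun j (k : 'I_s) => ((U *m grid_point g) j 0 / Num.sqrt s%:R) ^+ 2)) /=.
  rewrite (eq_bigr (fun j => (U *m grid_point g) j 0 ^+ 2)) => [|j _]; last first.
    rewrite sumr_const card_ord exprMn exprVn sqr_sqrtr ?ler0n //.
    by rewrite -[_ *+ s]mulr_natr divfK // pnatr_eq0 -lt0n.
  by rewrite -quad_form1 quad_form1_isometry.
(* The threshold is eps/2 because passing from the grid to all vectors costs a factor 2. *)
pose bad := [pred f : {ffun 'I_n * 'I_s -> 'I_m * bool} |
  [exists g, in_unit_ball g && (eps / 2 < `|Q f g|)]].
have eps2 : 0 < eps / 2 by rewrite divr_gt0.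
have Qp f g : Q f g ^+ p = `|Q f g| ^+ p.
  by rewrite -normrX ger0_norm // exprn_even_ge0.
have bad_le : #|bad|%:R <= delta * N.
  (* Markov's inequality for all grid points at once: a bad configuration contributes at least
     (eps/2)^p to the double sum. *)
  rewrite -(ler_pM2r (exprn_gt0 p eps2)).
  apply: (@le_trans _ _ (\sum_f \sum_(g | in_unit_ball g) Q f g ^+ p)).
    rewrite -sum1_card natr_sum mulr_suml big_mkcond; apply: ler_sum => f _.
    have Qge0 g : 0 <= Q f g ^+ p by rewrite Qp exprn_ge0.
    case: ifP => [/existsP[g /andP[g1 gQ]]|_]; last by rewrite sumr_ge0.
    rewrite mul1r (bigD1 g) //= Qp; apply: (@le_trans _ _ (`|Q f g| ^+ p)).
      by rewrite lerXn2r ?nnegrE // ltW.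
    by rewrite lerDl sumr_ge0.
  rewrite exchange_big /=.
  apply: le_trans (ler_sum _ (fun g g1 => moment g g1)) _.
  have ballE : #|in_unit_ball (R:=R) (r:=r)|%:R <= expR (27 * r%:R) :> R.
    exact: card_grid_le.
  rewrite sumr_const -[leLHS]mulr_natl; apply: le_trans (ler_wpM2r _ ballE) _.
    by rewrite !mulr_ge0 ?exprn_ge0 ?expR_ge0 ?ler0n // ltW.
  rewrite [leLHS](_ : _ = expR (27 * r%:R) * expR (- p%:R) * (N * (eps / 2) ^+ p)); last by ring.
  rewrite [leRHS](_ : _ = delta * (N * (eps / 2) ^+ p)); last by ring.
  apply: ler_wpM2r; first by rewrite mulr_ge0 ?exprn_ge0 ?ler0n // ltW.
  (* As p is at least 8 L = 32 r - 8 ln delta, the exponent 27 r - p is at most ln delta. *)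
  by rewrite -expRD -[leRHS]lnK ?posrE // ler_expR; lra.
have : (#|bad| + #|[pred f : {ffun 'I_n * 'I_s -> 'I_m * bool} |
    `[< subspace_embedding eps (hash_mx R f) A >]]|)%:R >= N.
  have NE : N = #|{: {ffun 'I_n * 'I_s -> 'I_m * bool}}|%:R.
    by rewrite card_ffun card_prod card_ord card_bool mulnC natrX.
  rewrite NE ler_nat -(cardC bad) leq_add2l; apply: subset_leq_card.
  apply/fintype.subsetP => f; rewrite !inE => /existsPn good; rewrite AE.
  apply: embedding_of_gram_defect => // y.
  rewrite (_ : eps = 2 * (eps / 2)); last by field.
  apply: quad_form_le_of_net => //.
    by rewrite /gram_defect linearB /= trmx1 trmx_mul trmxK.
  by move=> g g1; have := good g; rewrite g1 /= -leNgt.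
by rewrite natrD mulrBl mul1r -/N; lra.
Qed.

Theorem theorem2p4p3 (R : realType) :
  exists C C1 C2 : R,
    [/\ 0 < C, 0 < C1, 0 < C2
      & forall (eps delta E : R) (s r d n m : nat),
          0 < eps < 1 -> 0 < delta < 1 -> 0 < E ->
          (0 < s)%N -> (0 < r)%N -> (r <= d)%N -> (d <= n)%N ->
          (0 < m)%N -> (m <= n)%N ->
          C <= E ->
          E <= 2 * expR (4 * r%:R)
                 / ((4 * r%:R + ln (1 / delta)) * delta) ->
          E * C2 ^- 2 * eps ^- 2 * (4 * r%:R + ln (1 / delta)) <= m%:R ->
          forall A : 'M[R]_(n, d),
            \rank A = r ->
            coherence A <= mubar C1 C2 E eps delta r * Num.sqrt s%:R ->
            forall (disp : measure_display) (Omega : measurableType disp)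
                   (P : probability Omega R) (S : Omega -> 'M[R]_(m, n)),
              hashing_variant P s S ->
              ((1 - delta)%:E
                 <= P [set w | subspace_embedding eps (S w) A])%E].
Proof.
(* [C = e] makes ln E at least 1, and [C1 = 1/9] compensates the bound 9 L on the moment order. *)
exists (expR 1), 9^-1, (hash_C2 R); split; rewrite ?expR_gt0 ?invr_gt0 //.
move=> eps delta E s r d n m eps01 delta01 _ s0 r0 _ _ m0 _ Ee _ mE A rA mu_le.
move=> disp Omega P S [h [b [uh ub ind SE]]].
have [U [sigma [V [[UU _ _ AE] cohE]]]] := coherence_svd A.
rewrite rA in U sigma V UU AE cohE.
(* Each outcome of [S] is the matrix encoded by its hash configuration. *)
have -> : [set w | subspace_embedding eps (S w) A] =
    [set w | `[< subspace_embedding eps (hash_mx R (hash_config h b w)) A >]].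
  apply/seteqP; split => w /=; rewrite asboolE (_ : S w = hash_mx R (hash_config h b w)) //;
  apply/matrixP => i j; rewrite SE mxE; apply: eq_big => k; by rewrite ffunE.
rewrite (prob_hash_config_pred uh ub ind
  (fun f => `[< subspace_embedding eps (hash_mx R f) A >])).
rewrite lee_fin ler_pdivlMr ?exprn_gt0 ?ltr0n ?muln_gt0 //.
apply: (card_embedding_ge (B := diag_mx sigma *m V^T) eps01 delta01 s0 r0 m0 Ee mE UU).
  by rewrite mulmxA.
by rewrite -cohE.
Qed.
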